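(* For every $\beta>0$, there are constants $n_0 > 0$ and $\alpha > 0$ such that the following holds. Let $n,k$ be positive even integers such that $n > n_0$ and $k < \alpha \sqrt{n}$. Any two-party communication protocol that computes $\mathsf{EGH}_{n,k}$ over inputs from $U_{n,k}$ with success probability $2/3$ must have communication complexity at least $(1-\beta) n$.
   Context: For positive integers $n,k$, the exact gap-hamming function $\mathsf{EGH}_{n,k}:\{\pm1\}^n\times\{\pm1\}^n\to\{0,1,\star\}$ is defined by $\mathsf{EGH}_{n,k}(x,y)=1$ if $\langle x,y\rangle=k$, $\mathsf{EGH}_{n,k}(x,y)=0$ if $\langle x,y\rangle=-k$, and $\mathsf{EGH}_{n,k}(x,y)=\star$ otherwise, where $\langle x,y\rangle=\sum_j x_jy_j$. $U_{n,k}$ denotes the uniform distribution over the set of pairs $(x,y) \in \{\pm 1\}^n \times \{\pm 1\}^n$ with $\langle x,y\rangle \in \{k,-k\}$. Protocols are in the standard two-party communication model: Alice gets $x$, Bob gets $y$, they exchange bits, the output is determined by the transcript, and the communication complexity of the protocol is the maximal number of bits exchanged. A protocol computes $\mathsf{EGH}_{n,k}$ over inputs from $U_{n,k}$ with success probability $2/3$ if, when $(x,y)$ is sampled from $U_{n,k}$, the output equals $\mathsf{EGH}_{n,k}(x,y)$ with probability at least $2/3$ (over the input and any randomness of the protocol). *)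

(* Defs.v *)
From HB Require Import structures.
From mathcomp Require Import all_boot all_order all_algebra.
From mathcomp Require Import all_classical all_reals all_analysis.

Set Implicit Arguments.
Unset Strict Implicit.
Unset Printing Implicit Defensive.
Import Order.TTheory GRing.Theory Num.Theory.
Local Open Scope classical_set_scope.
Local Open Scope ring_scope.

(* The cube {-1, 1}^n, a bit b standing for the sign (-1) ^+ b. *)
Definition cube (n : nat) : finType := {ffun 'I_n -> bool}.

Definition inner (n : nat) (x y : cube n) : int :=
  \sum_(j < n) (-1) ^+ x j * (-1) ^+ y j.

(* The values 0, 1, star are Some false, Some true, None. *)
Definition EGH (n k : nat) (x y : cube n) : option bool :=
  if inner x y == k%:Z then Some true
  else if inner x y == - k%:Z then Some false
  else None.

Definition U_supp (n k : nat) : {set cube n * cube n} :=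
  [set xy | (inner xy.1 xy.2 == k%:Z) || (inner xy.1 xy.2 == - k%:Z)].

(* Probability mass function of the distribution U_{n,k}. *)
Definition U (R : realType) (n k : nat) (xy : cube n * cube n) : R :=
  if xy \in U_supp n k then (#|U_supp n k|%:R)^-1 else 0.

(* Deterministic two-party protocols. At a node, one party announces a bit
   computed from its own input, and the run moves to the first subtree when
   this bit is true, to the second one otherwise; the output is read off the
   leaf, i.e. it depends only on the transcript. *)
Inductive protocol (X Y O : Type) : Type :=
| Output of O
| Alice of (X -> bool) & protocol X Y O & protocol X Y O
| Bob of (Y -> bool) & protocol X Y O & protocol X Y O.

Fixpoint transcript (X Y O : Type) (p : protocol X Y O) (x : X) (y : Y) :
    seq bool :=
  match p with
  | Output _ => [::]
  | Alice f p1 p0 => f x :: transcript (if f x then p1 else p0) x y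
  | Bob g p1 p0 => g y :: transcript (if g y then p1 else p0) x y
  end.

Fixpoint output (X Y O : Type) (p : protocol X Y O) (x : X) (y : Y) : O :=
  match p with
  | Output o => o
  | Alice f p1 p0 => output (if f x then p1 else p0) x y
  | Bob g p1 p0 => output (if g y then p1 else p0) x y
  end.

(* A randomized protocol is a deterministic protocol chosen by the outcome of
   random coins on an arbitrary probability space, independently of the input.
   This is the public-coin model; deterministic protocols (one-point space) and
   private coins (an outcome w = (wA, wB) drawn from a product space, Alice's
   messages depending on wB only through the transcript, and symmetrically)
   are particular cases. *)
Record rprotocol (R : realType) (X Y O : Type) := RProtocol {
  coin_display : measure_display;
  coin : measurableType coin_display;
  coin_law : probability coin R;
  run : coin -> protocol X Y O;
  measurable_output : forall (x : X) (y : Y) (o : O),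
    measurable [set w : coin | output (run w) x y = o]
}.

(* Worst case over the inputs and the coins; +oo if unbounded. *)
Definition communication_complexity (R : realType) (X Y O : Type)
    (p : rprotocol R X Y O) : \bar R :=
  ereal_sup [set c | exists (w : coin p) (x : X) (y : Y),
                       c = (size (transcript (run w) x y))%:R%:E].

(* Probability that the output is EGH_{n,k}(x, y) when (x, y) is drawn from
   U_{n,k} and the coins are drawn independently of (x, y). *)
Definition EGH_success (R : realType) (n k : nat)
    (p : rprotocol R (cube n) (cube n) (option bool)) : \bar R :=
  (\sum_(xy : cube n * cube n)
     (U R k xy)%:E *
     coin_law p [set w : coin p |
                  output (run w) xy.1 xy.2 = EGH k xy.1 xy.2])%E.

(* Main.v *)
(* Write e(d) = exp (i theta d). On a rectangle A * B, Fourier inversion over the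
   frequencies theta = pi t / (2 n) turns the difference between the numbers of pairs with
   inner product k and -k into an average of sin (k theta) * Im (sum_{x, y} e(<x, y>)).
   The inner sums F(x) = sum_{y in B} e(<x, y>) satisfy
     sum_x |F(x)|^{2m} <= (2 exp eps)^n |B|^{2m - 1},
   by tensorization of a two-point inequality valid as soon as
   m (1 - |cos (2 theta)|) is large in terms of eps. Hence, if |A| |B| >= 2^n exp (2 eps n),
   the L^1 norm of F on A is at most |A| |B| exp (- c n sin^2 (2 theta)), and summing over the
   frequencies gives a bias O(k / n) |A| |B|. Adding up the rectangles of a protocol of cost
   (1 - beta) n, with eps = beta / 8, its advantage is O(k / n) 4^n plus an exponentially
   smaller term, while the support of U_{n,k} has at least 4^n / (4 sqrt n) elements. *)

Require Import Defs.
From HB Require Import structures.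
From mathcomp Require Import all_boot all_order all_algebra.
From mathcomp Require Import all_classical all_reals all_analysis.
From mathcomp Require Import measurable_realfun.
From mathcomp Require Import ring lra zify.

Set Implicit Arguments.
Unset Strict Implicit.
Unset Printing Implicit Defensive.
Import Order.TTheory GRing.Theory Num.Theory.
Local Open Scope ring_scope.

(** * Entropy estimates and the two-point inequality for weights of sum 1 *)

Section TwoPoint.
Variable R : realType.
Implicit Types a b l u s t x y eps K : R.

Lemma expR_convex2 a b x y : 0 <= a -> 0 <= b -> a + b = 1 ->
  expR (a * x + b * y) <= a * expR x + b * expR y.
Proof.
move=> a0 b0 ab1; set s := a * x + b * y.
have tangent z : expR s * (1 + (z - s)) <= expR z.
  have -> : expR z = expR s * expR (z - s) by rewrite -expRD; congr expR; ring.
  by rewrite ler_pM2l ?expR_gt0 // expR_ge1Dx.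
apply: le_trans (lerD (ler_wpM2l a0 (tangent x)) (ler_wpM2l b0 (tangent y))).
have -> : a * (expR s * (1 + (x - s))) + b * (expR s * (1 + (y - s))) =
    expR s * ((a + b) * (1 - s) + (a * x + b * y)) by ring.
by rewrite ab1 mul1r -/s subrK mulr1.
Qed.

Lemma ln_ge1BV x : 0 < x -> 1 - x^-1 <= ln x.
Proof.
move=> x0; have := @le_ln1Dx R (x^-1 - 1).
rewrite addrCA subrr addr0 lnV ?posrE // => /(_ _).
have : 0 < x^-1 by rewrite invr_gt0.
by move=> ? /(_ ltac:(lra)); lra.
Qed.

Lemma gibbs_term a l : 0 < a -> 0 < l -> a * ln l + (a - l) <= a * ln a.
Proof.
move=> a0 l0; have := ln_ge1BV (divr_gt0 a0 l0).
rewrite ln_div ?posrE // invf_div => /(ler_wpM2l (ltW a0)).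
have -> : a * (1 - l / a) = a - l by field; rewrite gt_eqF.
by rewrite mulrBr; lra.
Qed.

(** The corrections [a - l] and [b - u] left by [ln z >= 1 - 1/z] cancel because the total masses
    agree: this is the nonnegativity of relative entropy. *)
Lemma gibbs a b l u : 0 < a -> 0 < b -> 0 < l -> 0 < u -> a + b = l + u ->
  a * ln l + b * ln u <= a * ln a + b * ln b.
Proof.
by move=> a0 b0 l0 u0 e; have := gibbs_term a0 l0; have := gibbs_term b0 u0; lra.
Qed.

Lemma expR_entropy_ge_half a b : 0 < a -> 0 < b -> a + b = 1 ->
  2^-1 <= expR (a * ln a + b * ln b).
Proof.
move=> a0 b0 ab1; have h : (0 : R) < 2^-1 by rewrite invr_gt0.
have : a + b = 2^-1 + 2^-1 by rewrite ab1; field.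
move=> /(gibbs a0 b0 h h); rewrite -mulrDl ab1 mul1r => H.
by rewrite -[leLHS]lnK ?posrE // ler_expR.
Qed.

(** Here [s] and [t] are square roots of probabilities. From [ln s >= 1 - 1/s] comes
    [s^2 ln (s^2) >= - 2 s (1 - s)], and [1 - s <= t] because [s + t >= s^2 + t^2 = 1]. *)
Lemma entropy_ge s t : 0 < s -> 0 < t -> s ^+ 2 + t ^+ 2 = 1 ->
  - (4 * (s * t)) <= s ^+ 2 * ln (s ^+ 2) + t ^+ 2 * ln (t ^+ 2).
Proof.
have half x y : 0 < x -> 0 < y -> x ^+ 2 + y ^+ 2 = 1 ->
    - (2 * (x * y)) <= x ^+ 2 * ln (x ^+ 2).
  move=> x0 y0 e; rewrite lnXn // mulr2n.
  have x1 : x <= 1 by nra.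
  have y1 : y <= 1 by nra.
  have := ler_wpM2l (sqr_ge0 x) (ln_ge1BV x0).
  have -> : x ^+ 2 * (1 - x^-1) = x ^+ 2 - x by field; rewrite gt_eqF.
  have : x * (1 - x) <= x * y by rewrite ler_pM2l //; nra.
  by rewrite mulrDr; nra.
by move=> s0 t0 e; have := half s t s0 t0 e; have := half t s t0 s0; rewrite addrC => /(_ e); lra.
Qed.

(** Each quotient [a^(n+2) / l^n] is [a] times the exponential of [ln a + n (ln a - ln l)]. By
    convexity the sum is at least the exponential of the mean exponent, whose part in [n] is a
    relative entropy, hence nonnegative. *)
Lemma weighted_power_sum_ge a b l u n :
  0 < a -> 0 < b -> 0 < l -> 0 < u -> a + b = 1 -> l + u = 1 ->
  expR (a * ln a + b * ln b) <= a ^+ n.+2 / l ^+ n + b ^+ n.+2 / u ^+ n.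
Proof.
move=> a0 b0 l0 u0 ab1 lu1.
have tE x y : 0 < x -> 0 < y ->
    x ^+ n.+2 / y ^+ n = x * expR (ln x + n%:R * (ln x - ln y)).
  move=> x0 y0; rewrite expRD lnK ?posrE // expRM_natl expRB !lnK ?posrE //.
  by rewrite expr_div_n !exprS; ring.
rewrite !tE //; apply: le_trans (expR_convex2 _ _ (ltW a0) (ltW b0) ab1).
rewrite ler_expR; have := gibbs a0 b0 l0 u0; rewrite ab1 lu1 => /(_ erefl) g.
have -> : a * (ln a + n%:R * (ln a - ln l)) + b * (ln b + n%:R * (ln b - ln u)) =
    a * ln a + b * ln b + n%:R * (a * ln a + b * ln b - (a * ln l + b * ln u)) by ring.
by rewrite lerDl mulr_ge0 // subr_ge0.
Qed.

(** If [a * b] is bounded below, a power of order [eps^-3 / K] makes the second term on the left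
    negligible; if [a * b] is small, so is the entropy on the right. *)
Lemma two_point_normalized eps K q a b :
  0 < eps -> 0 <= K <= 1 -> 8 / eps ^+ 3 <= q%:R * K ->
  0 < a -> 0 < b -> a + b = 1 ->
  1 + (1 - 2 * K * (a * b)) ^+ q <= 2 * expR eps * expR (a * ln a + b * ln b).
Proof.
move=> e0 /andP[K0 K1] qK a0 b0 ab1.
have ab4 : a * b <= 4^-1 by have := sqr_ge0 (a - b); have -> : b = 1 - a by [lra]; lra.
have abK : 0 <= 1 - 2 * K * (a * b).
  have ab0 : 0 <= a * b by rewrite mulr_ge0 // ltW.
  have := ler_wpM2r ab0 K1; lra.
have powexp : (1 - 2 * K * (a * b)) ^+ q <= expR (- (2 * (q%:R * K) * (a * b))).
  have -> : - (2 * (q%:R * K) * (a * b)) = q%:R * - (2 * K * (a * b)) by ring.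
  rewrite expRM_natl lerXn2r // ?nnegrE ?expR_ge0 //.
  exact: expR_ge1Dx.
have ab0 : 0 < a * b by rewrite mulr_gt0.
have E1 : 1 + eps <= expR eps by exact: expR_ge1Dx.
(* Above this threshold [2 q K a b >= 1/eps], so the power is at most [exp (-1/eps) <= eps] while
   the right side is at least [exp eps]. Below it the entropy is at most [4 sqrt (a b) < eps], so
   the right side is at least 2. *)
case: (leP (eps ^+ 2 / 16) (a * b)) => [big|small].
- have half := expR_entropy_ge_half a0 b0 ab1.
  have y0 : 0 < eps^-1 by rewrite invr_gt0.
  have yle : eps^-1 <= 2 * (q%:R * K) * (a * b).
    have -> : eps^-1 = 2 * (8 / eps ^+ 3) * (eps ^+ 2 / 16).
      by field; rewrite gt_eqF.
    have p3 : 0 <= 8 / eps ^+ 3 by rewrite divr_ge0 // exprn_ge0 // ltW.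
    have p2 : 0 <= eps ^+ 2 / 16 by rewrite divr_ge0 // exprn_ge0 // ltW.
    by have := ler_pM p3 p2 qK big; rewrite -!(mulrA 2) ler_pM2l.
  have : expR (- (2 * (q%:R * K) * (a * b))) <= eps.
    rewrite expRN invf_ple ?posrE ?expR_gt0 //.
    apply: le_trans (expR_ge1Dx _); lra.
  move=> ?; have : expR eps <= 2 * expR eps * expR (a * ln a + b * ln b) .
    rewrite -mulrA mulrCA -[leLHS]mulr1 ler_pM2l ?expR_gt0 //; lra.
  lra.
- have sa0 : 0 < Num.sqrt a by rewrite sqrtr_gt0.
  have sb0 : 0 < Num.sqrt b by rewrite sqrtr_gt0.
  have sqa : Num.sqrt a ^+ 2 = a by rewrite sqr_sqrtr // ltW.
  have sqb : Num.sqrt b ^+ 2 = b by rewrite sqr_sqrtr // ltW.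
  have := @entropy_ge (Num.sqrt a) (Num.sqrt b) sa0 sb0; rewrite sqa sqb => /(_ ab1) ent.
  have st : Num.sqrt a * Num.sqrt b < eps / 4.
    rewrite -(@ltr_pXn2r _ 2) ?nnegrE // ?mulr_ge0 ?divr_ge0 ?(ltW e0) // ?ltW //.
    rewrite exprMn sqa sqb; apply: lt_le_trans small _.
    by rewrite expr_div_n; have -> : (4:R) ^+ 2 = 16 by ring.
  have : 1 <= expR eps * expR (a * ln a + b * ln b).
    by rewrite -expRD -[leLHS]expR0 ler_expR; lra.
  have : (1 - 2 * K * (a * b)) ^+ q <= 1.
    by apply: exprn_ile1 => //; rewrite lerBlDr lerDl !mulr_ge0 // ltW.
  by rewrite -mulrA; lra.
Qed.

End TwoPoint.

(** * The two-point inequality in homogeneous form *)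

Section TwoPointHomogeneous.
Variable R : realType.
Implicit Types a b eps K p : R.

(** The case where one of the two numbers vanishes and its logarithm is meaningless; [p1 <= p0 + p1]
    is enough. *)
Lemma two_point_degenerate eps q b p0 p1 :
  0 < eps -> 0 <= b -> 0 < p0 -> 0 < p1 ->
  b ^+ q.*2.+2 + b ^+ q.*2.+2 <=
    2 * expR eps * (p0 + p1) ^+ q.*2 * (b ^+ q.*2.+2 / p1 ^+ q.*2).
Proof.
move=> e0 b0 p00 p10.
have pow1 : 1 <= (p0 + p1) ^+ q.*2 / p1 ^+ q.*2.
  by rewrite -expr_div_n exprn_ege1 // ler_pdivlMr // mul1r lerDr ltW.
have -> : 2 * expR eps * (p0 + p1) ^+ q.*2 * (b ^+ q.*2.+2 / p1 ^+ q.*2) =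
  2 * (expR eps * ((p0 + p1) ^+ q.*2 / p1 ^+ q.*2)) * b ^+ q.*2.+2 by ring.
rewrite -mulr2n -[leLHS]mulr_natl ler_wpM2r ?exprn_ge0 //.
have E1 : 1 <= expR eps by rewrite -expR0 ler_expR ltW.
have := mulr_ege1 E1 pow1; lra.
Qed.

(** Both sides have degree [2q + 2] in [(a, b)] and 0 in [(p0, p1)], so both pairs may be normalized
    to sum 1. Then [two_point_normalized] and [weighted_power_sum_ge] chain through the exponential
    of minus the entropy. *)
Lemma two_point eps K q a b p0 p1 :
  0 < eps -> 0 <= K <= 1 -> 8 / eps ^+ 3 <= q.+1%:R * K ->
  0 <= a -> 0 <= b -> 0 < p0 -> 0 < p1 ->
  ((a + b) ^+ 2) ^+ q.+1 + ((a + b) ^+ 2 - 2 * K * (a * b)) ^+ q.+1 <=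
    2 * expR eps * (p0 + p1) ^+ q.*2 *
      (a ^+ q.*2.+2 / p0 ^+ q.*2 + b ^+ q.*2.+2 / p1 ^+ q.*2).
Proof.
move=> e0 K01 qK.
rewrite le_eqVlt => /predU1P[<-|a0].
  move=> b0 p00 p10; rewrite mul0r mulr0 subr0 add0r expr0n /= mul0r add0r.
  have -> : (b ^+ 2) ^+ q.+1 = b ^+ q.*2.+2 by rewrite -exprM mul2n doubleS.
  exact: two_point_degenerate.
rewrite le_eqVlt => /predU1P[<-|b0].
  move=> p00 p10; rewrite !mulr0 subr0 addr0 expr0n /= mul0r addr0.
  have -> : (a ^+ 2) ^+ q.+1 = a ^+ q.*2.+2 by rewrite -exprM mul2n doubleS.
  rewrite (addrC p0); apply: two_point_degenerate => //; exact: ltW.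
move=> p00 p10; set s := a + b; set p := p0 + p1.
have s0 : 0 < s by rewrite addr_gt0.
have p_gt0 : 0 < p by rewrite addr_gt0.
have [sN pN p0N p1N] : [/\ s != 0, p != 0, p0 != 0 & p1 != 0] by rewrite !gt_eqF.
have as0 : 0 < a / s by rewrite divr_gt0.
have bs0 : 0 < b / s by rewrite divr_gt0.
have abs1 : a / s + b / s = 1 by rewrite -mulrDl divff.
have lp1 : p0 / p + p1 / p = 1 by rewrite -mulrDl divff.
have := two_point_normalized e0 K01 qK as0 bs0 abs1.
have := weighted_power_sum_ge q.*2 as0 bs0 (divr_gt0 p00 p_gt0) (divr_gt0 p10 p_gt0) abs1 lp1.
have E0 : 0 <= 2 * expR eps by rewrite mulr_ge0 // expR_ge0.
move=> /(ler_wpM2l E0) w t; have {t w} := le_trans t w.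
have sq0 : 0 < s ^+ q.*2.+2 by rewrite exprn_gt0.
rewrite -(ler_pM2l sq0) => H; apply: le_trans (le_trans H _).
- have -> : (s ^+ 2) ^+ q.+1 = s ^+ q.*2.+2 by rewrite -exprM mul2n doubleS.
  rewrite mulrDr mulr1 lerD2l.
  have -> : s ^+ q.*2.+2 = (s ^+ 2) ^+ q.+1 by rewrite -exprM mul2n doubleS.
  rewrite -exprMn le_eqVlt; apply/orP; left; apply/eqP; congr (_ ^+ _).
  by field.
- rewrite le_eqVlt; apply/orP; left; apply/eqP.
  rewrite !expr_div_n.
  have zn (z : R) k : z != 0 -> z ^+ k != 0 by move=> z0; rewrite expf_neq0.
  by field; rewrite !zn.
Qed.

(* With u = (p, q) and v = (r, w) read as complex numbers and e^{i theta} = (c, s),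
   the first summand is |e^{i theta} u + e^{-i theta} v|^2 and the second one its
   conjugate rotation: both are at most (|u| + |v|)^2, and so is their average
   up to the factor |cos (2 theta)| of the cross term. *)
Lemma rotated_sum_bound (p q r w c s a b : R) n : c ^+ 2 + s ^+ 2 = 1 ->
  0 <= a -> 0 <= b -> a ^+ 2 = p ^+ 2 + q ^+ 2 -> b ^+ 2 = r ^+ 2 + w ^+ 2 ->
  ((c * p - s * q + (c * r + s * w)) ^+ 2 +
     (c * q + s * p + (c * w - s * r)) ^+ 2) ^+ n +
  ((c * p + s * q + (c * r - s * w)) ^+ 2 +
     (c * q - s * p + (c * w + s * r)) ^+ 2) ^+ n <=
  ((a + b) ^+ 2) ^+ n +
    ((a + b) ^+ 2 - 2 * (1 - `|c ^+ 2 - s ^+ 2|) * (a * b)) ^+ n.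
Proof.
move=> cs1 a0 b0 a2 b2.
set S1 := (X in X ^+ n + _ <= _); set S2 := (X in _ + X ^+ n <= _).
set K := `|_|.
have ab0 : 0 <= a * b by rewrite mulr_ge0.
have S1pos : 0 <= S1 by rewrite addr_ge0 ?sqr_ge0.
have S2pos : 0 <= S2 by rewrite addr_ge0 ?sqr_ge0.
(* The real and imaginary parts of [conj(u) v], whence [X^2 + Y^2 = |u|^2 |v|^2]. *)
set X := p * r + q * w; set Y := p * w - q * r.
have XY : X ^+ 2 + Y ^+ 2 = (a * b) ^+ 2 by rewrite exprMn a2 b2 /X /Y; ring.
have s2E : s ^+ 2 = 1 - c ^+ 2 by lra.
have S1E : S1 = a ^+ 2 + b ^+ 2 + 2 * ((c ^+ 2 - s ^+ 2) * X + 2 * c * s * Y).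
  transitivity ((c ^+ 2 + s ^+ 2) * (a ^+ 2 + b ^+ 2) +
    2 * ((c ^+ 2 - s ^+ 2) * X + 2 * c * s * Y)); last by rewrite cs1 mul1r.
  by rewrite a2 b2 /S1 /X /Y; ring.
have S2E : S2 = a ^+ 2 + b ^+ 2 + 2 * ((c ^+ 2 - s ^+ 2) * X - 2 * c * s * Y).
  transitivity ((c ^+ 2 + s ^+ 2) * (a ^+ 2 + b ^+ 2) +
    2 * ((c ^+ 2 - s ^+ 2) * X - 2 * c * s * Y)); last by rewrite cs1 mul1r.
  by rewrite a2 b2 /S2 /X /Y; ring.
have bound z : z ^+ 2 <= (a * b) ^+ 2 -> z <= a * b.
  move=> h; apply: le_trans (ler_norm z) _.
  by rewrite -(@ler_pXn2r _ 2) ?nnegrE // real_normK ?num_real.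
have rot : (c ^+ 2 - s ^+ 2) ^+ 2 + (2 * c * s) ^+ 2 = 1.
  by transitivity ((c ^+ 2 + s ^+ 2) ^+ 2); [ring | rewrite cs1 expr1n].
have sqD : (a + b) ^+ 2 = a ^+ 2 + b ^+ 2 + 2 * (a * b) by ring.
have clean (z y : R) : z <= y -> a ^+ 2 + b ^+ 2 + 2 * z <= a ^+ 2 + b ^+ 2 + 2 * y by lra.
have cauchy (u v x y : R) : (u * x + v * y) ^+ 2 <= (u ^+ 2 + v ^+ 2) * (x ^+ 2 + y ^+ 2).
  rewrite -subr_ge0 [leRHS](_ : _ = (u * y - v * x) ^+ 2) ?sqr_ge0 //; ring.
have S1le : S1 <= (a + b) ^+ 2.
  suff : (c ^+ 2 - s ^+ 2) * X + 2 * c * s * Y <= a * b by rewrite S1E sqD => /clean.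
  by apply: bound; have := cauchy (c ^+ 2 - s ^+ 2) (2 * c * s) X Y; rewrite rot mul1r XY.
have S2le : S2 <= (a + b) ^+ 2.
  suff : (c ^+ 2 - s ^+ 2) * X - 2 * c * s * Y <= a * b by rewrite S2E sqD => /clean.
  apply: bound; have := cauchy (c ^+ 2 - s ^+ 2) (2 * c * s) X (- Y).
  by rewrite sqrrN mulrN rot mul1r XY.
have S12 : S1 + S2 <= 2 * ((a + b) ^+ 2 - 2 * (1 - K) * (a * b)).
  suff h : (c ^+ 2 - s ^+ 2) * X <= K * (a * b).
    rewrite -subr_ge0.
    have -> : 2 * ((a + b) ^+ 2 - 2 * (1 - K) * (a * b)) - (S1 + S2) =
      4 * (K * (a * b) - (c ^+ 2 - s ^+ 2) * X) by rewrite S1E S2E; ring.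
    by rewrite mulr_ge0 // subr_ge0.
  apply: le_trans (ler_norm _) _; rewrite normrM ler_wpM2l ?normr_ge0 //.
  rewrite -(@ler_pXn2r _ 2) ?nnegrE // real_normK ?num_real // -XY lerDl.
  exact: sqr_ge0.
(* The smaller of [S1], [S2] is at most their average, the larger at most [(a + b)^2]. *)
case: (leP S1 S2) => h; last first.
  by apply: lerD; apply: lerXn2r; rewrite ?nnegrE //; lra.
by rewrite addrC; apply: lerD; apply: lerXn2r; rewrite ?nnegrE //; lra.
Qed.

End TwoPointHomogeneous.

(** * Decomposition of the cube along its first coordinate *)

Definition cube_cons (n : nat) (b : bool) (x : cube n) : cube n.+1 :=
  [ffun i => if unlift ord0 i is Some j then x j else b].

Definition slice (n : nat) (b : bool) (B : {set cube n.+1}) : {set cube n} :=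
  [set y | cube_cons b y \in B].

Lemma cube_cons0 n b (x : cube n) : cube_cons b x ord0 = b.
Proof. by rewrite ffunE unlift_none. Qed.

Lemma cube_consS n b (x : cube n) i : cube_cons b x (lift ord0 i) = x i.
Proof. by rewrite ffunE liftK. Qed.

Lemma inner_cube_cons n b c (x y : cube n) :
  inner (cube_cons b x) (cube_cons c y) = (-1) ^+ (b (+) c) + inner x y.
Proof.
rewrite /inner big_ord_recl !cube_cons0 -signr_addb; congr (_ + _).
by apply: eq_bigr => i _; rewrite !cube_consS.
Qed.

Lemma sum_cubeS (V : nmodType) n (F : cube n.+1 -> V) :
  \sum_x F x = \sum_x (F (cube_cons false x) + F (cube_cons true x)).
Proof.
pose h (bx : cube n * bool) := cube_cons bx.2 bx.1.
pose g (x : cube n.+1) : cube n * bool := ([ffun i => x (lift ord0 i)], x ord0).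
rewrite (reindex h) /=; last first.
  exists g => [[x b] _|x _]; rewrite /g /h /=.
    by rewrite cube_cons0; congr (_, _); apply/ffunP => i; rewrite ffunE cube_consS.
  apply/ffunP => i; case: (unliftP ord0 i) => [j|] ->; first by rewrite cube_consS ffunE.
  by rewrite cube_cons0.
rewrite -(pair_big xpredT xpredT (fun x b => F (cube_cons b x))) /=.
by apply: eq_bigr => x _; rewrite big_bool addrC.
Qed.

Lemma sum_in_cubeS (V : nmodType) n (B : {set cube n.+1}) (F : cube n.+1 -> V) :
  \sum_(y in B) F y = \sum_(y in slice false B) F (cube_cons false y) +
                      \sum_(y in slice true B) F (cube_cons true y).
Proof.
rewrite big_mkcond sum_cubeS big_split /=; congr (_ + _);
  by rewrite [RHS]big_mkcond; apply: eq_bigr => y _; rewrite inE.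
Qed.

Lemma card_slices n (B : {set cube n.+1}) :
  #|B| = (#|slice false B| + #|slice true B|)%N.
Proof. by rewrite -!sum1_card (@sum_in_cubeS nat). Qed.

(** * Moments of the exponential sums *)

Section Moments.
Variable R : realType.
Implicit Types theta : R.

(** Together with [sin_sum], the real and imaginary parts of the sum [F(x)] of [e^{i theta <x, y>}]
    over [y] in [B]. *)
Definition cos_sum n theta (B : {set cube n}) (x : cube n) : R :=
  \sum_(y in B) cos (theta * (inner x y)%:~R).

Definition sin_sum n theta (B : {set cube n}) (x : cube n) : R :=
  \sum_(y in B) sin (theta * (inner x y)%:~R).

(** Agreement in the first coordinate multiplies the exponential by [e^{i theta}], disagreement by
    [e^{-i theta}]; this is the real part of the resulting identity. *)
Lemma cos_sum_cons n theta (B : {set cube n.+1}) b x :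
  cos_sum theta B (cube_cons b x) =
    (cos theta * cos_sum theta (slice b B) x - sin theta * sin_sum theta (slice b B) x) +
    (cos theta * cos_sum theta (slice (~~ b) B) x +
     sin theta * sin_sum theta (slice (~~ b) B) x).
Proof.
have same c : \sum_(y in slice c B) cos (theta * (inner (cube_cons c x) (cube_cons c y))%:~R) =
    cos theta * cos_sum theta (slice c B) x - sin theta * sin_sum theta (slice c B) x.
  rewrite !mulr_sumr -sumrB; apply: eq_bigr => y _.
  by rewrite inner_cube_cons addbb expr0 rmorphD mulrDr mulr1 cosD.
have diff c : \sum_(y in slice (~~ c) B)
      cos (theta * (inner (cube_cons c x) (cube_cons (~~ c) y))%:~R) =
    cos theta * cos_sum theta (slice (~~ c) B) x + sin theta * sin_sum theta (slice (~~ c) B) x.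
  rewrite !mulr_sumr -big_split; apply: eq_bigr => y _ /=.
  by rewrite inner_cube_cons addbN addbb expr1 rmorphD mulrDr mulrN1 cosD cosN sinN mulNr opprK.
by rewrite /cos_sum sum_in_cubeS; case: b; [rewrite addrC|]; rewrite (same _) -(diff _).
Qed.

Lemma sin_sum_cons n theta (B : {set cube n.+1}) b x :
  sin_sum theta B (cube_cons b x) =
    (cos theta * sin_sum theta (slice b B) x + sin theta * cos_sum theta (slice b B) x) +
    (cos theta * sin_sum theta (slice (~~ b) B) x -
     sin theta * cos_sum theta (slice (~~ b) B) x).
Proof.
have same c : \sum_(y in slice c B) sin (theta * (inner (cube_cons c x) (cube_cons c y))%:~R) =
    cos theta * sin_sum theta (slice c B) x + sin theta * cos_sum theta (slice c B) x.
  rewrite !mulr_sumr -big_split; apply: eq_bigr => y _ /=.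
  by rewrite inner_cube_cons addbb expr0 rmorphD mulrDr mulr1 sinD addrC.
have diff c : \sum_(y in slice (~~ c) B)
      sin (theta * (inner (cube_cons c x) (cube_cons (~~ c) y))%:~R) =
    cos theta * sin_sum theta (slice (~~ c) B) x - sin theta * cos_sum theta (slice (~~ c) B) x.
  rewrite !mulr_sumr -sumrB; apply: eq_bigr => y _ /=.
  by rewrite inner_cube_cons addbN addbb expr1 rmorphD mulrDr mulrN1 sinD cosN sinN mulNr addrC.
by rewrite /sin_sum sum_in_cubeS; case: b; [rewrite addrC|]; rewrite (same _) -(diff _).
Qed.

(** Induction on the dimension: [two_point] is applied with the sizes of the two slices of [B] as
    weights. The hypothesis on a slice [C], divided by [#|C|^(2q)], leaves a single factor [#|C|],
    and these add up to [#|B|]. *)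
Lemma moment_bound (eps : R) theta q n (B : {set cube n}) :
  0 < eps -> 8 / eps ^+ 3 <= q.+1%:R * (1 - `|cos theta ^+ 2 - sin theta ^+ 2|) ->
  \sum_x (cos_sum theta B x ^+ 2 + sin_sum theta B x ^+ 2) ^+ q.+1 <=
    (2 * expR eps) ^+ n * #|B|%:R ^+ q.*2.+1.
Proof.
move=> e0 Kq.
have trig : cos theta ^+ 2 + sin theta ^+ 2 = 1 by exact: cos2Dsin2.
have K01 : 0 <= 1 - `|cos theta ^+ 2 - sin theta ^+ 2| <= 1.
  rewrite subr_ge0 gerBl normr_ge0 andbT ler_norml.
  have := sqr_ge0 (cos theta); have := sqr_ge0 (sin theta); lra.
elim: n B => [|n IHn] B.
  (* In dimension 0, [B] has at most one point, so the powers [2q + 2] and [2q + 1] of its size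
     coincide. *)
  have card1 : #|cube 0| = 1%N by rewrite card_ffun card_bool card_ord.
  have := max_card (mem B); rewrite card1 => B1.
  have inner0 (x y : cube 0) : inner x y = 0 by rewrite /inner big_ord0.
  rewrite (eq_bigr (fun=> #|B|%:R ^+ q.+1.*2)) => [|x _]; last first.
    rewrite /cos_sum /sin_sum.
    under eq_bigr do rewrite inner0 mulr0 cos0.
    under [in X in _ + X]eq_bigr do rewrite inner0 mulr0 sin0.
    by rewrite !sumr_const mul0rn expr0n addr0 -exprM mul2n.
  rewrite sumr_const card1 mulr1n expr0 mul1r.
  by case: #|B| B1 => [|[|]] // _; rewrite ?expr0n ?expr1n.

pose norm_sum (C : {set cube n}) x := Num.sqrt (cos_sum theta C x ^+ 2 + sin_sum theta C x ^+ 2).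
have norm0 (C : {set cube n}) x : 0 <= norm_sum C x by exact: sqrtr_ge0.
have norm2 (C : {set cube n}) x :
    norm_sum C x ^+ 2 = cos_sum theta C x ^+ 2 + sin_sum theta C x ^+ 2.
  by rewrite sqr_sqrtr // addr_ge0 // sqr_ge0.
have moment (C : {set cube n}) :
    \sum_x norm_sum C x ^+ q.*2.+2 <= (2 * expR eps) ^+ n * #|C|%:R ^+ q.*2.+1.
  apply: le_trans (IHn C); rewrite le_eqVlt; apply/orP; left; apply/eqP.
  by apply: eq_bigr => x _; rewrite -norm2 -exprM mul2n.
rewrite sum_cubeS.
set K := 1 - _ in Kq K01.
have step x : (cos_sum theta B (cube_cons false x) ^+ 2 +
       sin_sum theta B (cube_cons false x) ^+ 2) ^+ q.+1 +
     (cos_sum theta B (cube_cons true x) ^+ 2 +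
       sin_sum theta B (cube_cons true x) ^+ 2) ^+ q.+1 <=
    let a := norm_sum (slice false B) x in let b := norm_sum (slice true B) x in
    ((a + b) ^+ 2) ^+ q.+1 + ((a + b) ^+ 2 - 2 * K * (a * b)) ^+ q.+1.
  (* Changing the first bit of [x] exchanges the roles of the slices, that is, of [e^{i theta}] and
     [e^{-i theta}]: these are the two summands of [rotated_sum_bound]. *)
  apply: le_trans (rotated_sum_bound q.+1 trig (norm0 _ _) (norm0 _ _) (norm2 _ _) (norm2 _ _)).
  rewrite !cos_sum_cons !sin_sum_cons /=.
  rewrite le_eqVlt; apply/orP; left; apply/eqP.
  by congr (_ + _); congr (_ ^+ _); ring.
apply: (le_trans (ler_sum _ (fun x _ => step x))) => {step} /=.
have E0 : 0 <= 2 * expR eps by rewrite mulr_ge0 // expR_ge0.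
have exprE (z : R) : (z ^+ 2) ^+ q.+1 = z ^+ q.*2.+2 by rewrite -exprM mul2n.
have empty (C : {set cube n}) x : #|C| = 0%N -> norm_sum C x = 0.
  move/eqP; rewrite cards_eq0 => /eqP ->.
  by rewrite /norm_sum /cos_sum /sin_sum !big_set0 expr0n addr0 sqrtr0.
(* An empty slice cannot serve as a positive weight in [two_point]; the other slice then carries
   everything, and [1 <= expR eps] suffices. *)
have single (C D : {set cube n}) : #|C| = 0%N ->
    \sum_x (norm_sum D x ^+ q.*2.+2 + norm_sum D x ^+ q.*2.+2) <=
    (2 * expR eps) ^+ n.+1 * (#|C| + #|D|)%:R ^+ q.*2.+1.
  move=> ->; rewrite add0n big_split /= exprS -!mulrA.
  have m0 : 0 <= \sum_x norm_sum D x ^+ q.*2.+2 by apply: sumr_ge0 => x _; rewrite exprn_ge0.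
  have E1 : 1 <= expR eps by rewrite -expR0 ler_expR ltW.
  have := ler_pM ler01 m0 E1 (moment D); lra.
rewrite card_slices.
have [C0|C0] := posnP #|slice false B|.
  apply: le_trans (single _ _ C0); apply: ler_sum => x _.
  by rewrite (empty _ _ C0) add0r mul0r mulr0 subr0 !exprE.
have [C1|C1] := posnP #|slice true B|.
  rewrite addnC; apply: le_trans (single _ _ C1); apply: ler_sum => x _.
  by rewrite (empty _ _ C1) addr0 !mulr0 subr0 !exprE.
have p0 : 0 < #|slice false B|%:R :> R by rewrite ltr0n.
have p1 : 0 < #|slice true B|%:R :> R by rewrite ltr0n.
have pt x := two_point e0 K01 Kq (norm0 (slice false B) x) (norm0 (slice true B) x) p0 p1.
apply: (le_trans (ler_sum _ (fun x _ => pt x))) => {pt}.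
rewrite -mulr_sumr big_split -!mulr_suml /= natrD exprS.
set p := (X in X + _); set r := (X in _ + X).
have pr0 : 0 < p + r by rewrite addr_gt0.
have mom (C : {set cube n}) : 0 < #|C|%:R :> R ->
    (\sum_x norm_sum C x ^+ q.*2.+2) / #|C|%:R ^+ q.*2 <= (2 * expR eps) ^+ n * #|C|%:R.
  move=> c0; rewrite ler_pdivrMr ?exprn_gt0 // -mulrA -exprS; exact: moment.
have h : 0 <= 2 * expR eps * (p + r) ^+ q.*2 by rewrite mulr_ge0 // exprn_ge0 // ltW.
apply: le_trans (ler_wpM2l h (lerD (mom _ p0) (mom _ p1))) _.
rewrite le_eqVlt; apply/orP; left; apply/eqP.
by rewrite -mulrDr -/p -/r (exprS (p + r)); ring.
Qed.

End Moments.

(** * From moments to an L1 bound at a fixed frequency *)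

Section Frequency.
Variable R : realType.
Implicit Types eps theta : R.

Lemma bernoulli_ge (w : R) n : 0 <= w -> 1 + n%:R * (w - 1) <= w ^+ n.
Proof.
move=> w0; elim: n => [|n IHn]; first by rewrite mul0r addr0 expr0.
rewrite exprSr; have : 0 <= n%:R * (w - 1) ^+ 2 by rewrite mulr_ge0 // sqr_ge0.
have := ler_wpM2r w0 IHn; rewrite -[n.+1%:R]natr1; lra.
Qed.

(** With [N = 2 (q + 1)] and [z = #|B| exp (- eps n / N)], the lower bound on the area says
    precisely that [moment_bound] is at most [#|A| z^N]; hence the mean of [|sin_sum|] over [A] is
    at most [z]. *)
Lemma sin_sum_L1 eps theta q n (A B : {set cube n}) :
  0 < eps -> 8 / eps ^+ 3 <= q.+1%:R * (1 - `|cos theta ^+ 2 - sin theta ^+ 2|) ->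
  2 ^+ n * expR (2 * eps * n%:R) <= #|A|%:R * #|B|%:R ->
  \sum_(x in A) `|sin_sum theta B x| <=
    #|A|%:R * #|B|%:R * expR (- (eps * n%:R / (2 * q.+1%:R))).
Proof.
move=> e0 Kq big.
have big0 : 0 < #|A|%:R * #|B|%:R :> R.
  by apply: lt_le_trans big; rewrite mulr_gt0 ?exprn_gt0 ?expR_gt0.
have B0 : 0 < #|B|%:R :> R.
  by rewrite lt0r ler0n andbT; apply: contraTneq big0 => ->; rewrite mulr0 ltxx.
set N := q.*2.+2.
have NE : 2 * q.+1%:R = N%:R :> R by rewrite -natrM mul2n.
rewrite NE; set z := #|B|%:R * expR (- (eps * n%:R / N%:R)).
have z0 : 0 < z by rewrite mulr_gt0 ?expR_gt0.
have N0 : 0 < N%:R :> R by rewrite ltr0n.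
have zN : z ^+ N = #|B|%:R ^+ N * expR (- (eps * n%:R)).
  rewrite exprMn -expRM_natl; congr (_ * expR _).
  by field; rewrite gt_eqF.
rewrite -mulrA -/z -ler_pdivrMr // mulr_suml.
(* Young's inequality [w <= 1 - 1/N + w^N / N], which is Bernoulli's at [w], replaces Hölder's. *)
have pt x : `|sin_sum theta B x| / z <=
    1 - N%:R^-1 + (`|sin_sum theta B x| ^+ N / z ^+ N) / N%:R.
  set w := _ / z; have w0 : 0 <= w by rewrite divr_ge0 // ltW.
  rewrite -expr_div_n -/w -(ler_pM2r N0) mulrDl mulrBl mul1r mulVf ?gt_eqF // divfK ?gt_eqF //.
  have := bernoulli_ge N w0; lra.
apply: le_trans (ler_sum _ (fun x _ => pt x)) _.
rewrite big_split /= sumr_const -[(1 - _) *+ _]mulr_natl mulrBr mulr1 -!mulr_suml.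
rewrite -addrA gerDl addrC subr_le0 ler_pM2r ?invr_gt0 //.
rewrite ler_pdivrMr ?exprn_gt0 //.
apply: (@le_trans _ _ ((2 * expR eps) ^+ n * #|B|%:R ^+ q.*2.+1)).
  apply: le_trans (moment_bound B e0 Kq).
  rewrite [leRHS](bigID (mem A)) /= -[leLHS]addr0; apply: lerD.
    apply: ler_sum => x _; rewrite /N -doubleS -mul2n exprM lerXn2r ?nnegrE ?sqr_ge0 //.
      by rewrite addr_ge0 // sqr_ge0.
    by rewrite real_normK ?num_real // lerDr sqr_ge0.
  by apply: sumr_ge0 => x _; rewrite exprn_ge0 // addr_ge0 // sqr_ge0.
rewrite zN (exprS _ q.*2.+1) exprMn -expRM_natl.
have E : expR (2 * eps * n%:R) * expR (- (eps * n%:R)) = expR (n%:R * eps).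
  by rewrite -expRD; congr expR; ring.
have h : 0 <= #|B|%:R ^+ q.*2.+1 * expR (- (eps * n%:R)).
  by rewrite mulr_ge0 ?expR_ge0.
by have := ler_wpM2r h big; rewrite -E; lra.
Qed.

(* The rate obtained by optimizing the moment 2 (q + 1) against the frequency. *)
Definition decay eps : R := eps / (4 * (8 / eps ^+ 3 + 1)).

Lemma decay_gt0 eps : 0 < eps -> 0 < decay eps.
Proof. by move=> e0; rewrite divr_gt0 // mulr_gt0 // addr_gt0 // divr_gt0 // exprn_gt0. Qed.

(** With [C = 8 / eps^3], the choice of [q] as the floor of [C / K] is admissible and keeps
    [(q + 1) K <= C + 1]; the rate [eps / (2 (q + 1))] is then comparable to [K], and
    [sin^2 (2 theta) <= 2 K]. *)
Lemma sin_sum_frequency eps theta n (A B : {set cube n}) :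
  0 < eps -> 2 ^+ n * expR (2 * eps * n%:R) <= #|A|%:R * #|B|%:R ->
  \sum_(x in A) `|sin_sum theta B x| <=
    #|A|%:R * #|B|%:R * expR (- (decay eps * n%:R * sin (theta *+ 2) ^+ 2)).
Proof.
move=> e0 big; set y := cos theta ^+ 2 - sin theta ^+ 2.
have trig : cos theta ^+ 2 + sin theta ^+ 2 = 1 by exact: cos2Dsin2.
have sinE : sin (theta *+ 2) ^+ 2 = 1 - y ^+ 2.
  have -> : 1 = (cos theta ^+ 2 + sin theta ^+ 2) ^+ 2 :> R by rewrite trig expr1n.
  by rewrite sin_mulr2n /y; ring.
have y1 : `|y| <= 1.
  rewrite /y ler_norml; have := sqr_ge0 (cos theta); have := sqr_ge0 (sin theta); lra.
have yy : y ^+ 2 = `|y| ^+ 2 by rewrite real_normK ?num_real.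
have C0 : 0 < 8 / eps ^+ 3 by rewrite divr_gt0 // exprn_gt0.
(* When [K = 0] no [q] is admissible, but [sin (2 theta) = 0] and the claim is the trivial bound by
   the area. *)
move: y1; rewrite le_eqVlt => /predU1P[y1|y1].
  rewrite sinE yy y1 expr1n subrr mulr0 oppr0 expR0 mulr1.
  have -> : #|A|%:R * #|B|%:R = \sum_(x in A) #|B|%:R :> R by rewrite sumr_const mulr_natl.
  apply: ler_sum => x _; apply: le_trans (ler_norm_sum _ _ _) _.
  rewrite -sumr_const; apply: ler_sum => z _.
  by rewrite ler_norml sin_geN1 sin_le1.
set K := 1 - `|y|; have K0 : 0 < K by rewrite subr_gt0.
have K1 : K <= 1 by rewrite gerBl.
set q := Num.truncn (8 / eps ^+ 3 / K).
have /andP[qlo qhi] : q%:R <= 8 / eps ^+ 3 / K < q.+1%:R.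
  by rewrite truncn_itv // divr_ge0 ?ltW.
have Kq : 8 / eps ^+ 3 <= q.+1%:R * K by rewrite -ler_pdivrMr // ltW.
apply: le_trans (sin_sum_L1 e0 Kq big) _.
rewrite ler_wpM2l ?mulr_ge0 // ler_expR lerN2.
have qK : q.+1%:R * K <= 8 / eps ^+ 3 + 1.
  rewrite -natr1 mulrDl mul1r lerD // -ler_pdivlMr //.
have q0 : 0 < 2 * q.+1%:R :> R by rewrite mulr_gt0.
rewrite ler_pdivlMr // /decay.
have D0 : 0 < 4 * (8 / eps ^+ 3 + 1) by rewrite mulr_gt0 // addr_gt0.
have -> : eps / (4 * (8 / eps ^+ 3 + 1)) * n%:R * sin (theta *+ 2) ^+ 2 * (2 * q.+1%:R) =
  eps * n%:R * (2 * q.+1%:R * sin (theta *+ 2) ^+ 2 / (4 * (8 / eps ^+ 3 + 1))) by ring.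
rewrite -[leRHS]mulr1 ler_wpM2l ?mulr_ge0 ?(ltW e0) // ler_pdivrMr // mul1r.
have s2K : sin (theta *+ 2) ^+ 2 <= 2 * K.
  rewrite sinE yy /K; have := normr_ge0 y; have := sqr_ge0 (1 - `|y|); nra.
have := ler_wpM2l (ltW q0) s2K; lra.
Qed.

End Frequency.

(** * Discrete Fourier inversion and bounds on the sine *)

Section Fourier.
Import numFieldNormedType.Exports.
Variable R : realType.
Implicit Types M : nat.

(** Half of the angle [2 pi t / M]: it gets multiplied by even inner products [2 e], which yields
    the characters of the integers modulo [M] at [e]. *)
Definition freq M (t : nat) : R := pi * t%:R / M%:R.

Lemma sin_sub_multiple_2pi (j : nat) (b : R) : sin (pi * j%:R * 2 - b) = - sin b.
Proof.
elim: j => [|j IHj]; first by rewrite mulr0 mul0r sub0r sinN.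
rewrite -IHj -[RHS]sinD2pi; congr sin; rewrite -natr1 -[pi *+ 2]mulr_natr; ring.
Qed.

(** Multiplied by [2 sin b], nonzero since [0 < b < pi], the terms telescope: [2 sin b cos (2 b t) =
    sin ((2t + 1) b) - sin ((2t - 1) b)]. *)
Lemma sum_cos_eq0 M (j : nat) : (0 < j < M)%N ->
  \sum_(0 <= t < M) cos (freq M t *+ 2 * j%:R) = 0.
Proof.
move=> /andP[j0 jM]; pose b : R := pi * j%:R / M%:R.
have M0 : 0 < M%:R :> R by rewrite ltr0n (leq_trans _ jM).
have bpi : 0 < b < pi.
  apply/andP; split; first by rewrite divr_gt0 // mulr_gt0 ?pi_gt0 ?ltr0n.
  by rewrite ltr_pdivrMr // ltr_pM2l ?pi_gt0 // ltr_nat.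
have sinb := sin_gt0_pi bpi.
pose f t : R := sin (t%:R * (b * 2) - b).
have step t : 2 * sin b * cos (freq M t *+ 2 * j%:R) = f t.+1 - f t.
  have -> : freq M t *+ 2 * j%:R = t%:R * (b * 2).
    by rewrite /freq -mulr_natr /b; field; rewrite gt_eqF.
  rewrite /f; have -> : t.+1%:R * (b * 2) - b = t%:R * (b * 2) + b.
    by rewrite -natr1; ring.
  by rewrite !sinD cosN sinN; ring.
have sN : 2 * sin b != 0 by apply: lt0r_neq0; exact: mulr_gt0 (ltr0Sn R 1) sinb.
apply: (mulfI sN); rewrite mulr0 mulr_sumr.
rewrite (eq_bigr (fun t => f t.+1 - f t)) => [|t _]; last exact: step.
rewrite telescope_sumr // /f mul0r sub0r sinN.
have -> : M%:R * (b * 2) = pi * j%:R * 2 by rewrite /b; field; rewrite gt_eqF.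
by rewrite sin_sub_multiple_2pi subrr.
Qed.

Lemma sum_cos_int M (z : int) : (0 < M)%N -> (`|z| < M)%N ->
  \sum_(0 <= t < M) cos (freq M t *+ 2 * z%:~R) = if z == 0 then M%:R else 0.
Proof.
move=> M0 zM; case: eqVneq => [->|z0].
  under eq_bigr do rewrite mulr0 cos0.
  by rewrite sumr_const_nat subn0.
rewrite -[RHS](@sum_cos_eq0 M `|z|%N) ?absz_gt0 ?z0 //.
apply: eq_bigr => t _; case: z {z0 zM} => m; first by [].
by rewrite NegzE abszN mulrNz mulrN cosN.
Qed.

(** Product formula for sines, then orthogonality at [k - e] and [k + e]; the size conditions
    exclude nonzero multiples of [M]. *)
Lemma fourier_sign M (k e : int) : (absz (k - e)%R < M)%N -> (absz (k + e)%R < M)%N ->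
  \sum_(0 <= t < M) 2 * (sin (freq M t *+ 2 * k%:~R) * sin (freq M t *+ 2 * e%:~R)) =
    M%:R * ((e == k)%:R - (e == - k)%:R).
Proof.
move=> km kp; have M0 : (0 < M)%N by apply: leq_ltn_trans km.
rewrite (eq_bigr (fun t => cos (freq M t *+ 2 * (k - e)%:~R) -
                           cos (freq M t *+ 2 * (k + e)%:~R))) => [|t _]; last first.
  by rewrite rmorphB rmorphD mulrBr mulrDr cosB cosD; ring.
rewrite sumrB !sum_cos_int // subr_eq0 (addrC k e) addr_eq0 (eq_sym k e).
by case: (e == k); case: (e == - k); rewrite /= ?subrr ?subr0 ?sub0r ?mulr1 ?mulr0 ?mulrN1.
Qed.

Lemma normr_sin_mulrn (x : R) k : `|sin (x * k%:R)| <= k%:R * `|sin x|.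
Proof.
elim: k => [|k IHk]; first by rewrite mulr0 sin0 normr0 mul0r.
rewrite -natr1 mulrDr mulr1 sinD mulrDl mul1r.
apply: le_trans (ler_normD _ _) _; rewrite !normrM; apply: lerD.
  apply: le_trans _ IHk; rewrite ler_piMr ?normr_ge0 // ler_norml.
  by rewrite cos_geN1 cos_le1.
by rewrite ler_piMl ?normr_ge0 // ler_norml cos_geN1 cos_le1.
Qed.

Lemma sin_mean_value (x : R) : 0 < x -> exists2 c, 0 < c < x & sin x = x * cos c.
Proof.
move=> x0; have [|c] := @MVT R sin cos 0 x x0 (fun y _ => is_derive_sin y).
  by apply: continuous_subspaceT; exact: continuous_sin.
by rewrite in_itv /= sin0 !subr0 => cx ->; exists c => //; rewrite mulrC.
Qed.

(** For the lower bound, [sin x = 2 sin (x/2) cos (x/2) = x cos c cos (x/2)] with [c < x/2], so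
    [cos c >= cos (x/2)], and [2 cos^2 (x/2) = 1 + cos x >= 1]. *)
Lemma sin_bounds (x : R) : 0 <= x <= pi / 2 -> x / 2 <= sin x <= x.
Proof.
move=> /andP[]; rewrite le_eqVlt => /predU1P[<-|x0] xpi.
  by rewrite sin0 mul0r lexx.
have pi0 := pi_gt0 R.
apply/andP; split; last first.
  have [c _ ->] := sin_mean_value x0.
  by rewrite ler_piMr ?cos_le1 // ltW.
have y0 : 0 < x / 2 by rewrite divr_gt0.
have [c /andP[c0 cx] sc] := sin_mean_value y0.
have cosx0 : 0 <= cos x by apply: cos_ge0_pihalf; rewrite xpi; lra.
have cosy : cos x = cos (x / 2) ^+ 2 *+ 2 - 1.
  by rewrite -cos_mulr2n -[_ *+ 2]mulr_natr divfK.
have cosy0 : 0 <= cos (x / 2) by apply: cos_ge0_pihalf; lra.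
have coscy : cos (x / 2) <= cos c.
  by rewrite ltW // ltr_cos // in_itv /=; apply/andP; split; lra.
have xE : x = (x / 2) *+ 2 by rewrite -[RHS]mulr_natr divfK.
have -> : sin x = 2 * (x / 2 * cos c) * cos (x / 2).
  by rewrite -sc [in LHS]xE sin_mulr2n; ring.
have h : cos (x / 2) ^+ 2 <= cos c * cos (x / 2) by rewrite expr2 ler_wpM2r.
have h2 : 2^-1 <= cos c * cos (x / 2) by move: cosy; rewrite -mulr_natr; lra.
have -> : 2 * (x / 2 * cos c) * cos (x / 2) = x * (cos c * cos (x / 2)) by field.
by rewrite ler_pM2l.
Qed.

End Fourier.

(** * Summation of the decay over the frequencies *)

Section Discrepancy.
Variable R : realType.
Implicit Types c q eps : R.

(** The summand is dominated by a multiple of a difference of [1 / (1 + q t^2)], and the sum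
    telescopes. The constant comes from [1 + q (t+1)^2 <= 4 (1 + q t^2)], valid from [t = 1] on. *)
Lemma sum_rational_decay q T : 0 < q ->
  \sum_(0 <= t < T) t%:R / (1 + q * t%:R ^+ 2) ^+ 2 <= 2 / q.
Proof.
move=> q0; pose G t : R := (1 + q * t%:R ^+ 2)^-1.
have Gpos t : 0 < 1 + q * t%:R ^+ 2 :> R.
  by rewrite ltr_pwDl // mulr_ge0 ?exprn_ge0 // ltW.
have step t : t%:R / (1 + q * t%:R ^+ 2) ^+ 2 <= 2 / q * (G t - G t.+1).
  case: t => [|t].
    rewrite mul0r mulr_ge0 ?divr_ge0 ?(ltW q0) // subr_ge0 /G.
    by rewrite lef_pV2 ?posrE // lerD2l ler_wpM2l ?(ltW q0) // lerXn2r ?nnegrE // ler_nat.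
  rewrite /G; set u : R := t.+1%:R.
  have u1 : 1 <= u by rewrite ler1n.
  have -> : t.+2%:R = u + 1 by rewrite -natr1.
  have P0 : 0 < 1 + q * u ^+ 2 by exact: Gpos.
  have P1 : 0 < 1 + q * (u + 1) ^+ 2 by rewrite /u natr1; exact: Gpos.
  have -> : 2 / q * ((1 + q * u ^+ 2)^-1 - (1 + q * (u + 1) ^+ 2)^-1) =
      2 * (2 * u + 1) / ((1 + q * u ^+ 2) * (1 + q * (u + 1) ^+ 2)).
    have zy : (1 + q * (u + 1) ^+ 2) - (1 + q * u ^+ 2) = q * (2 * u + 1) by ring.
    have yz (y z : R) : 0 < y -> 0 < z -> y^-1 - z^-1 = (z - y) / (y * z).
      by move=> y0 z0; field; rewrite !gt_eqF.
    by rewrite yz // zy !mulrA divfK ?gt_eqF.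
  have P01 : 1 + q * (u + 1) ^+ 2 <= 4 * (1 + q * u ^+ 2).
    have : q * (u + 1) ^+ 2 <= q * (4 * u ^+ 2) by rewrite ler_pM2l //; nra.
    lra.
  rewrite ler_pdivrMr ?exprn_gt0 // mulrAC ler_pdivlMr ?mulr_gt0 //.
  set y := 1 + q * u ^+ 2 in P0 P01 *; set z := 1 + _ in P1 P01 *.
  have y2 : 0 <= y ^+ 2 by exact: sqr_ge0.
  have : u * y * z <= u * y * (4 * y) by rewrite ler_pM2l // mulr_gt0 //; lra.
  lra.
apply: le_trans (ler_sum _ (fun t _ => step t)) _.
rewrite -mulr_sumr -[leRHS]mulr1 ler_wpM2l ?divr_ge0 ?(ltW q0) //.
rewrite (eq_bigr (fun t => - G t.+1 - - G t)) => [|t _]; last by rewrite opprK addrC.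
rewrite telescope_sumr // opprK /G expr0n mulr0 addr0 invr1 gerDr oppr_le0.
by rewrite invr_ge0 ltW // Gpos.
Qed.

Lemma expRN_le_rational (y : R) : 0 <= y -> expR (- y) <= 1 / (1 + y / 2) ^+ 2.
Proof.
move=> y0; have h : 0 < 1 + y / 2 by rewrite ltr_pwDl // divr_ge0.
rewrite expRN -div1r ler_pM2l // lef_pV2 ?posrE ?expR_gt0 ?exprn_gt0 //.
have -> : y = 2%:R * (y / 2) by field.
have -> : 2%:R * (y / 2) / 2 = y / 2 by field.
by rewrite expRM_natl lerXn2r ?nnegrE ?(ltW h) ?expR_ge0 // expR_ge1Dx.
Qed.

(** The angles cover one full turn; by the symmetries of the sine, four quarter turns remain, each
    contributing at most [8 / c]. The bound is free of [n], the step [pi / n] being offset by the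
    factor [n] in the exponent. *)
Lemma sum_sin_decay c n : 0 < c -> (0 < n)%N ->
  \sum_(0 <= t < n.*2) `|sin (freq R n.*2 t *+ 2)| *
     expR (- (c * n%:R * sin (freq R n.*2 t *+ 2) ^+ 2)) <= 32 / c.
Proof.
move=> c0 n0; have nR : 0 < n%:R :> R by rewrite ltr0n.
have p0 : 0 < pi :> R by exact: pi_gt0.
pose F (u : R) := `|u| * expR (- (c * n%:R * u ^+ 2)).
have FN u : F (- u) = F u by rewrite /F normrN sqrrN.
pose phi t : R := pi / n%:R * t%:R.
have phiE t : freq R n.*2 t *+ 2 = phi t.
  by rewrite /phi /freq -mul2n natrM -[_ *+ 2]mulr_natr; field; rewrite gt_eqF.
(* Chosen so that [c n (phi t / 2)^2 = 2 q t^2], where [phi t / 2] is the lower bound for the sine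
   on the first quarter. *)
pose q : R := c * n%:R * (pi / n%:R) ^+ 2 / 8.
have q0 : 0 < q.
  by apply: divr_gt0 => //; apply: mulr_gt0; [exact: mulr_gt0 | apply/exprn_gt0/divr_gt0].
pose g t : R := pi / n%:R * (t%:R / (1 + q * t%:R ^+ 2) ^+ 2).
have pn : 0 <= pi / n%:R :> R by rewrite divr_ge0 ?ltW.
have g0 t : 0 <= g t.
  by rewrite mulr_ge0 // divr_ge0 ?sqr_ge0.
have quarter t : (t.*2 <= n)%N -> F (sin (phi t)) <= g t.
  move=> tn; have phi0 : 0 <= phi t by rewrite mulr_ge0 // divr_ge0 // ltW.
  have /sin_bounds/andP[lo hi] : 0 <= phi t <= pi / 2.
    rewrite phi0 /= /phi mulrAC -mulrA ler_pM2l // ler_pdivrMr //.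
    by rewrite ler_pdivlMl // -natrM ler_nat mul2n.
  have s0 : 0 <= sin (phi t) by apply: le_trans lo; rewrite divr_ge0.
  rewrite /F /g ger0_norm // [leRHS]mulrA; apply: (ler_pM s0 (expR_ge0 _) hi).
  have sq : (phi t / 2) ^+ 2 <= sin (phi t) ^+ 2 by rewrite lerXn2r ?nnegrE // divr_ge0.
  have cn : 0 < c * n%:R by rewrite mulr_gt0.
  apply: (@le_trans _ _ (expR (- (q * t%:R ^+ 2 * 2)))).
    rewrite ler_expR lerN2; apply: le_trans (ler_wpM2l (ltW cn) sq).
    by rewrite le_eqVlt; apply/orP; left; apply/eqP; rewrite /q /phi; field; rewrite gt_eqF.
  apply: le_trans (expRN_le_rational _) _; last by rewrite mulfK // div1r.
  by rewrite !mulr_ge0 ?exprn_ge0 // ltW.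
have half t : (t <= n)%N -> F (sin (phi t)) <= g t + g (n - t)%N.
  move=> tn; case: (leqP t.*2 n) => h.
    by apply: le_trans (quarter _ h) _; rewrite lerDl.
  have -> : sin (phi t) = sin (phi (n - t)%N).
    rewrite -[LHS]opprK -sinN -sinDpi; congr sin.
    by rewrite /phi natrB //; field; rewrite gt_eqF.
  by apply: le_trans (quarter _ _) _; [lia | rewrite lerDr].
have sumg T : \sum_(0 <= t < T) g t <= 8 / c.
  rewrite -mulr_sumr.
  apply: le_trans (ler_wpM2l pn (sum_rational_decay T q0)) _.
  have -> : pi / n%:R * (2 / q) = 16 / (c * pi).
    by rewrite /q; move: (pi : R) p0 => w w0; field; rewrite !gt_eqF.
  rewrite ler_pdivrMr ?mulr_gt0 //.
  have -> : 8 / c * (c * pi) = 8 * pi by move: (pi : R) => w; field; rewrite gt_eqF.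
  have := pi_ge2 R; lra.
have period : \sum_(0 <= t < n) F (sin (phi t)) <= 16 / c.
  apply: (@le_trans _ _ (\sum_(0 <= t < n) (g t + g (n - t)%N))).
    by rewrite !big_mkord; apply: ler_sum => t _; apply: half; rewrite ltnW.
  rewrite big_split /=; have := sumg n.
  have : \sum_(0 <= t < n) g (n - t)%N <= \sum_(0 <= t < n.+1) g t.
    rewrite [leRHS]big_nat_rev /= big_nat_recr //= add0n.
    by rewrite lerDl.
  by have := sumg n.+1; lra.
rewrite (eq_bigr (fun t => F (sin (phi t)))) => [|t _]; last by rewrite phiE.
rewrite (@big_cat_nat _ _ _ n) //=; last by rewrite -addnn leq_addr.
have -> : \sum_(n <= t < n.*2) F (sin (phi t)) = \sum_(0 <= t < n) F (sin (phi t)).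
  rewrite -{1}[n]add0n big_addn -addnn addnK; apply: eq_bigr => t _.
  rewrite -[RHS]FN -sinDpi; congr (F (sin _)).
  by rewrite /phi natrD; field; rewrite gt_eqF.
lra.
Qed.

End Discrepancy.

(** * Inner products as Hamming distances and the discrepancy of rectangles *)

Definition hamming (n : nat) (x y : cube n) : nat := #|[set j | x j != y j]|.

Lemma inner_hamming n (x y : cube n) : inner x y = n%:Z - (hamming x y).*2%:Z.
Proof.
rewrite /inner (eq_bigr (fun j => 1 - (x j != y j)%:R *+ 2)) => [|j _]; last first.
  by rewrite -signr_addb; case: (x j); case: (y j).
rewrite sumrB sumr_const card_ord sumrMnl -natr_sum.
have -> : (\sum_(j < n) (x j != y j))%N = hamming x y.
  rewrite /hamming -sum1_card [RHS]big_mkcond /=.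
  by apply: eq_bigr => j _; rewrite inE; case: (x j != y j).
by rewrite -muln2 PoszM !natz -[_ *+ 2]mulr_natr.
Qed.

Lemma hamming_le n (x y : cube n) : (hamming x y <= n)%N.
Proof. by apply: leq_trans (max_card _) _; rewrite card_ord. Qed.

Section Bias.
Variable R : realType.
Implicit Types eps : R.

Definition bias n k (A B : {set cube n}) : R :=
  \sum_(x in A) \sum_(y in B) ((inner x y == k%:Z)%:R - (inner x y == - k%:Z)%:R).

(** Inner products are even, equal to [2 e] with [|e| <= h], so [|k - e|] and [|k + e|] are at most
    [2h], below the modulus [4h], and [fourier_sign] applies to each pair. *)
Lemma bias_fourier h k (A B : {set cube h.*2}) : (k <= h)%N -> (0 < h)%N ->
  h.*2.*2%:R * bias k.*2 A B =
    \sum_(0 <= t < h.*2.*2) 2 * (sin (freq R h.*2.*2 t *+ 2 * k%:R) *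
       \sum_(x in A) sin_sum (freq R h.*2.*2 t) B x).
Proof.
move=> kh h0; rewrite /bias mulr_sumr.
under [RHS]eq_bigr do rewrite !mulr_sumr.
rewrite exchange_big /=; apply: eq_bigr => x _.
rewrite mulr_sumr /sin_sum; under [RHS]eq_bigr do rewrite !mulr_sumr.
rewrite exchange_big /=; apply: eq_bigr => y _.
set e : int := h%:Z - (hamming x y)%:Z.
have innerE : inner x y = e * 2 by rewrite inner_hamming /e; lia.
have hl := hamming_le x y.
have -> : (inner x y == k.*2%:Z) = (e == k%:Z) by rewrite innerE; lia.
have -> : (inner x y == - k.*2%:Z) = (e == - k%:Z) by rewrite innerE; lia.
rewrite -fourier_sign; [|rewrite /e; lia..].
apply: eq_bigr => t _; congr (_ * (_ * sin _)).
by rewrite innerE rmorphM /= -mulr_natr; ring.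
Qed.

Lemma bias_le_area n k (A B : {set cube n}) : `|bias k A B| <= #|A|%:R * #|B|%:R.
Proof.
have -> : #|A|%:R * #|B|%:R = \sum_(x in A) \sum_(y in B) 1 :> R.
  by rewrite !sumr_const -[RHS]mulr_natl.
apply: le_trans (ler_norm_sum _ _ _) _; apply: ler_sum => x _.
apply: le_trans (ler_norm_sum _ _ _) _; apply: ler_sum => y _.
by case: (_ == _); case: (_ == _); rewrite ?subrr ?subr0 ?sub0r ?normrN ?normr0 ?normr1.
Qed.

(** A small rectangle is bounded by its area, which is the additive term. On a large one,
    [|sin (2 k theta)| <= k |sin (2 theta)|] reduces the Fourier sum to [sum_sin_decay]. *)
Lemma discrepancy eps h k (A B : {set cube h.*2}) :
  0 < eps -> (k <= h)%N -> (0 < h)%N ->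
  `|bias k.*2 A B| <=
    32 / decay eps * (k%:R / h.*2%:R) * (#|A|%:R * #|B|%:R) +
    2 ^+ h.*2 * expR (2 * eps * h.*2%:R).
Proof.
move=> e0 kh h0; have c0 := decay_gt0 e0.
have AB0 : 0 <= #|A|%:R * #|B|%:R :> R by rewrite mulr_ge0.
have n0 : 0 < h.*2%:R :> R by rewrite ltr0n double_gt0.
have main0 : 0 <= 32 / decay eps * (k%:R / h.*2%:R) * (#|A|%:R * #|B|%:R).
  by rewrite mulr_ge0 // mulr_ge0 // divr_ge0 // ltW.
case: (lerP (2 ^+ h.*2 * expR (2 * eps * h.*2%:R)) (#|A|%:R * #|B|%:R)) => [big|small]; last first.
  apply: le_trans (bias_le_area _ _ _) _; apply: le_trans (ltW small) _; lra.
apply: (@le_trans _ _ (32 / decay eps * (k%:R / h.*2%:R) * (#|A|%:R * #|B|%:R))); last first.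
  by rewrite lerDl mulr_ge0 ?exprn_ge0 ?expR_ge0.
have M0 : 0 < h.*2.*2%:R :> R by rewrite ltr0n !double_gt0.
rewrite -(ler_pM2l M0) -{1}(gtr0_norm M0) -normrM bias_fourier //.
apply: (@le_trans _ _ (\sum_(0 <= t < h.*2.*2) 2 * k%:R * (#|A|%:R * #|B|%:R) *
    (`|sin (freq R h.*2.*2 t *+ 2)| *
     expR (- (decay eps * h.*2%:R * sin (freq R h.*2.*2 t *+ 2) ^+ 2))))).
  apply: le_trans (ler_norm_sum _ _ _) _; apply: ler_sum => t _.
  rewrite normrM (ger0_norm (ler0n R 2)) normrM -!mulrA ler_pM2l //.
  have F1 := normr_sin_mulrn (freq R h.*2.*2 t *+ 2) k.
  have F2 : `|\sum_(x in A) sin_sum (freq R h.*2.*2 t) B x| <= #|A|%:R * #|B|%:R *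
      expR (- (decay eps * h.*2%:R * sin (freq R h.*2.*2 t *+ 2) ^+ 2)).
    exact: le_trans (ler_norm_sum _ _ _) (sin_sum_frequency _ e0 big).
  apply: le_trans (ler_pM (normr_ge0 _) (normr_ge0 _) F1 F2) _.
  by rewrite le_eqVlt; apply/orP; left; apply/eqP; rewrite -!mulrA; ring.
rewrite -mulr_sumr.
have P0 : 0 <= 2 * k%:R * (#|A|%:R * #|B|%:R) :> R by rewrite mulr_ge0 // mulr_ge0.
have n0' : (0 < h.*2)%N by rewrite double_gt0.
apply: le_trans (ler_wpM2l P0 (sum_sin_decay c0 n0')) _.
rewrite le_eqVlt; apply/orP; left; apply/eqP.
rewrite -[h.*2.*2]mul2n natrM; move: (decay eps) c0 => c c0.
by field; rewrite !gt_eqF.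
Qed.

End Bias.

(** * From rectangles to protocols *)

Section Protocols.
Variable R : realType.
Variables n k : nat.
Hypothesis k_gt0 : (0 < k)%N.
Implicit Types (A B : {set cube n}) (p : protocol (cube n) (cube n) (option bool)).

Definition supp_count A B : R :=
  \sum_(x in A) \sum_(y in B) ((x, y) \in U_supp n k)%:R.

Definition correct_count p A B : R :=
  \sum_(x in A) \sum_(y in B)
    (((x, y) \in U_supp n k) && (output p x y == EGH k x y))%:R.

Lemma inner_neq (x y : cube n) : inner x y = k%:Z -> (inner x y == - k%:Z) = false.
Proof. by move=> ->; lia. Qed.

Lemma correct_count_leaf o A B :
  2 * correct_count (Output _ _ o) A B <= supp_count A B + `|bias R k A B|.
Proof.
have [s sE] : exists s : R, `|s| <= 1 /\ forall x y : cube n,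
    2 * (((x, y) \in U_supp n k) && (o == EGH k x y))%:R <=
    ((x, y) \in U_supp n k)%:R +
      s * ((inner x y == k%:Z)%:R - (inner x y == - k%:Z)%:R) :> R.
  (* On the support, correctness of the output [o] is half of 1 plus or minus the sign of the inner
     product; a star is never correct there. *)
  exists (if o is Some b then (-1) ^+ (~~ b) else 0); split.
    by case: o => [[]|]; rewrite ?expr0 ?expr1 ?normrN ?normr1 ?normr0.
  move=> x y; rewrite inE /EGH /=; case: eqVneq => [/inner_neq ->|_].
    by case: o => [[]|] /=; rewrite ?expr0 ?expr1; lra.
  by case: eqVneq => _; case: o => [[]|] /=; rewrite ?expr0 ?expr1; lra.
case: sE => s1 sE.
apply: (@le_trans _ _ (supp_count A B + s * bias R k A B)); last first.
  rewrite lerD2l; apply: le_trans (ler_norm _) _.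
  by rewrite normrM ler_piMl ?normr_ge0.
rewrite /correct_count /supp_count /bias !mulr_sumr -big_split /=.
apply: ler_sum => x _; rewrite !mulr_sumr -big_split /=.
by apply: ler_sum => y _; exact: sE.
Qed.

Lemma sum_setIC (V : nmodType) A (f : cube n -> bool) (F : cube n -> V) :
  \sum_(x in A) F x =
    \sum_(x in [set x in A | f x]) F x + \sum_(x in [set x in A | ~~ f x]) F x.
Proof.
rewrite (bigID f) /=; congr (_ + _); by apply: eq_bigl => x; rewrite inE.
Qed.

Lemma card_setIC A (f : cube n -> bool) :
  #|A| = (#|[set x in A | f x]| + #|[set x in A | ~~ f x]|)%N.
Proof. by rewrite -!sum1_card (@sum_setIC nat A f). Qed.

(** Each message splits the rectangle in two. The support and area terms are additive under
    splitting, while [tau] is paid once per leaf, at most [2^c] times. *)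
Lemma correct_count_le (d tau : R) : 0 <= d -> 0 <= tau ->
  (forall A B, `|bias R k A B| <= d * (#|A|%:R * #|B|%:R) + tau) ->
  forall p c A B, (forall x y, x \in A -> y \in B -> size (transcript p x y) <= c)%N ->
  2 * correct_count p A B <= supp_count A B + d * (#|A|%:R * #|B|%:R) + 2 ^+ c * tau.
Proof.
move=> d0 tau0 disc; elim => [out|f p1 IH1 p0 IH0 | g p1 IH1 p0 IH0] c A B size_c.
- apply: le_trans (correct_count_leaf _ _ _) _; rewrite -addrA lerD2l.
  apply: le_trans (disc A B) _; rewrite lerD2l -[leLHS]mul1r ler_wpM2r //.
  by rewrite exprn_ege1 // ler1n.
(* For [c = 0] a node that sends a bit leaves no pair in the rectangle. *)
- case: c size_c => [|c] size_c.
    have -> : correct_count (Alice f p1 p0) A B = 0.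
      by apply: big1 => x xA; apply: big1 => y yB; have := size_c x y xA yB.
    rewrite mulr0 !addr_ge0 ?mulr_ge0 ?exprn_ge0 //.
    by apply: sumr_ge0 => x _; apply: sumr_ge0.
  have H1 : 2 * correct_count p1 [set x in A | f x] B <= supp_count [set x in A | f x] B +
      d * (#|[set x in A | f x]|%:R * #|B|%:R) + 2 ^+ c * tau.
    apply: IH1 => x y; rewrite inE => /andP[xA fx] yB.
    by have := size_c x y xA yB; rewrite /= fx ltnS.
  have H0 : 2 * correct_count p0 [set x in A | ~~ f x] B <= supp_count [set x in A | ~~ f x] B +
      d * (#|[set x in A | ~~ f x]|%:R * #|B|%:R) + 2 ^+ c * tau.
    apply: IH0 => x y; rewrite inE => /andP[xA /negPf fx] yB.
    by have := size_c x y xA yB; rewrite /= fx ltnS.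
  have -> : correct_count (Alice f p1 p0) A B =
      correct_count p1 [set x in A | f x] B + correct_count p0 [set x in A | ~~ f x] B.
    rewrite /correct_count (sum_setIC A f); congr (_ + _); apply: eq_bigr => x.
      by rewrite inE => /andP[_ fx]; apply: eq_bigr => y _; rewrite /= fx.
    by rewrite inE => /andP[_ /negPf fx]; apply: eq_bigr => y _; rewrite /= fx.
  have -> : supp_count A B = supp_count [set x in A | f x] B + supp_count [set x in A | ~~ f x] B.
    exact: sum_setIC.
  by rewrite (card_setIC A f) natrD exprS; lra.
- case: c size_c => [|c] size_c.
    have -> : correct_count (Bob g p1 p0) A B = 0.
      by apply: big1 => x xA; apply: big1 => y yB; have := size_c x y xA yB.
    rewrite mulr0 !addr_ge0 ?mulr_ge0 ?exprn_ge0 //.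
    by apply: sumr_ge0 => x _; apply: sumr_ge0.
  have H1 : 2 * correct_count p1 A [set y in B | g y] <= supp_count A [set y in B | g y] +
      d * (#|A|%:R * #|[set y in B | g y]|%:R) + 2 ^+ c * tau.
    apply: IH1 => x y xA; rewrite inE => /andP[yB gy].
    by have := size_c x y xA yB; rewrite /= gy ltnS.
  have H0 : 2 * correct_count p0 A [set y in B | ~~ g y] <= supp_count A [set y in B | ~~ g y] +
      d * (#|A|%:R * #|[set y in B | ~~ g y]|%:R) + 2 ^+ c * tau.
    apply: IH0 => x y xA; rewrite inE => /andP[yB /negPf gy].
    by have := size_c x y xA yB; rewrite /= gy ltnS.
  have -> : correct_count (Bob g p1 p0) A B =
      correct_count p1 A [set y in B | g y] + correct_count p0 A [set y in B | ~~ g y].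
    rewrite /correct_count -big_split; apply: eq_bigr => x _ /=.
    rewrite (sum_setIC B g); congr (_ + _); apply: eq_bigr => y.
      by rewrite inE => /andP[_ gy]; rewrite gy.
    by rewrite inE => /andP[_ /negPf gy]; rewrite gy.
  have -> : supp_count A B = supp_count A [set y in B | g y] + supp_count A [set y in B | ~~ g y].
    by rewrite /supp_count -big_split; apply: eq_bigr => x _; exact: sum_setIC.
  by rewrite (card_setIC B g) natrD exprS; lra.
Qed.

End Protocols.

(** * Size of the support of the distribution *)

Definition flip (n : nat) (x : cube n) (T : {set 'I_n}) : cube n := [ffun j => x j (+) (j \in T)].

Lemma hamming_flip n (x : cube n) T : hamming x (flip x T) = #|T|.
Proof.
by congr #|pred_of_set _|; apply/setP => j; rewrite inE ffunE; case: (x j); case: (j \in T).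
Qed.

(** Flipping [h - k] coordinates of any [x] gives a partner with inner product
    [2h - 2 (h - k) = 2k]. *)
Lemma card_U_supp_ge h k : (k <= h)%N ->
  (2 ^ h.*2 * 'C(h.*2, h - k) <= #|U_supp h.*2 k.*2|)%N.
Proof.
move=> kh; pose D := finset.setX [set: cube h.*2] [set T : {set 'I_h.*2} | #|T| == h - k]%N.
pose f (xT : cube h.*2 * {set 'I_h.*2}) := (xT.1, flip xT.1 xT.2).
have finj : injective f.
  move=> [x T] [x' T'] [/= <-] /ffunP E; congr (_, _); apply/setP => j.
  by have := E j; rewrite !ffunE => /addbI.
have -> : (2 ^ h.*2 * 'C(h.*2, h - k))%N = #|f @: D|.
  rewrite card_imset // cardsX cardsT card_ffun card_bool card_ord card_draws.
  by rewrite card_ord.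
apply/subset_leq_card/fintype.subsetP => z /imsetP[[x T] /finset.setXP[_ /=] Th ->].
move: Th; rewrite inE => /eqP cT; rewrite inE /= inner_hamming hamming_flip cT.
by apply/orP; left; lia.
Qed.

(** The square of [C(2m, m) >= 4^m / (2 sqrt m)], kept in the naturals. The ratio of consecutive
    central coefficients is [2 (2m + 1) / (m + 1)], and the induction rests on
    [4 m (m + 1) <= (2m + 1)^2]. *)
Lemma bin_center h : (16 ^ h.+1 <= 4 * h.+1 * 'C(h.+1.*2, h.+1) ^ 2)%N.
Proof.
elim: h => [|h IHh]; first by [].
have rec : (h.+2 * 'C(h.+2.*2, h.+2) = 2 * (h.+1.*2.+1) * 'C(h.+1.*2, h.+1))%N.
  have e1 := mul_bin_diag h.+2.*2 h.+1; have e2 := mul_bin_diag h.+1.*2.+1 h.+1.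
  have e3 : 'C(h.+1.*2.+1, h.+1) = 'C(h.+1.*2.+1, h.+2).
    by rewrite -[LHS]bin_sub; [congr 'C(_, _); lia | lia].
  rewrite doubleS /= e3 in e1; rewrite /= in e2; rewrite -e1.
  rewrite -doubleS -[h.+2.*2]mul2n -mulnA -e2 mulnA; lia.
set C := 'C(h.+2.*2, _) in rec *; set D := 'C(h.+1.*2, _) in rec IHh.
rewrite -(leq_pmul2l (ltn0Sn h.+1)) expnS.
have -> : (h.+2 * (4 * h.+2 * C ^ 2) = 4 * (h.+2 * C) ^ 2)%N by rewrite !expnS; lia.
rewrite rec.
have -> : (4 * (2 * h.+1.*2.+1 * D) ^ 2 = 16 * (h.+1.*2.+1 ^ 2 * D ^ 2))%N.
  by rewrite !expnS; lia.
rewrite mulnCA leq_pmul2l //; apply: leq_trans (leq_mul (leqnn h.+2) IHh) _.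
rewrite !mulnA leq_mul2r; apply/orP; right; rewrite expnS expn1; nia.
Qed.

Section Binomials.
Variable R : realType.

(** One step away from the center multiplies the coefficient by [(h - k) / (h + k + 1) >= 1 - (2k +
    1) / h], and the odd numbers [2i + 1] with [i < k] sum to [k^2]. *)
Lemma bin_near_center h k : (k <= h)%N ->
  (h%:R - k%:R ^+ 2) * 'C(h.*2, h)%:R <= h%:R * 'C(h.*2, h - k)%:R :> R.
Proof.
elim: k => [|k IHk] kh; first by rewrite expr0n subr0 subn0.
have {IHk} := IHk (ltnW kh).
have rec : (h + k.+1)%:R * 'C(h.*2, h - k.+1)%:R = (h - k)%:R * 'C(h.*2, h - k)%:R :> R.
  rewrite -!natrM; congr _%:R; have := mul_bin_left h.*2 (h - k.+1).
  have -> : (h - k.+1).+1 = (h - k)%N by lia.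
  by move=> ->; congr (_ * _)%N; lia.
move: rec; rewrite natrB ?(ltnW kh) // natrD -natr1.
set x := 'C(_, h - k)%:R; set y := 'C(_, h - k.+1)%:R; set c := 'C(_, h)%:R.
have [x0 y0 c0] : [/\ 0 <= x, 0 <= y & 0 <= c] by [].
have hk : k%:R <= h%:R :> R by rewrite ler_nat ltnW.
have k0 : 0 <= k%:R :> R by [].
have h0 : 0 < h%:R :> R by rewrite ltr0n (leq_trans _ kh).
move: (h%:R : R) (k%:R : R) h0 k0 hk => H K H0 K0 HK rec IH.
(* If [H < 2 K + 1] then [H <= (K + 1)^2] and the left side is nonpositive. *)
case: (lerP (2 * K + 1) H) => small; last first.
  apply: (@le_trans _ _ 0); last by rewrite mulr_ge0 // ltW.
  by rewrite mulr_le0_ge0 // subr_le0; nra.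
have Hy : (H - (2 * K + 1)) * x <= H * y.
  rewrite -(ler_pM2l (_ : 0 < H + (K + 1))); last lra.
  have -> : (H + (K + 1)) * (H * y) = H * ((H - K) * x) by rewrite -rec; ring.
  rewrite -subr_ge0.
  have -> : H * ((H - K) * x) - (H + (K + 1)) * ((H - (2 * K + 1)) * x) =
    (2 * K + 1) * (K + 1) * x by ring.
  by rewrite mulr_ge0 // mulr_ge0 //; lra.
rewrite -(ler_pM2l H0); apply: le_trans (ler_wpM2l (ltW H0) Hy).
have small0 : 0 <= H - (2 * K + 1) by lra.
have := ler_wpM2l small0 IH.
have : 0 <= (2 * K + 1) * K ^+ 2 * c by rewrite mulr_ge0 // mulr_ge0 ?exprn_ge0 //; lra.
lra.
Qed.

Lemma U_supp_large h k : (0 < h)%N -> (2 * k ^ 2 <= h)%N ->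
  (2 ^+ h.*2) ^+ 2 <= 4 * Num.sqrt h.*2%:R * #|U_supp h.*2 k.*2|%:R :> R.
Proof.
move=> h0 kh; have kle : (k <= h)%N by case: k kh => // k; nia.
have hR : 0 < h%:R :> R by rewrite ltr0n.
have center : 2 ^+ h.*2 <= 2 * Num.sqrt h.*2%:R * 'C(h.*2, h)%:R :> R.
  rewrite -(@ler_pXn2r _ 2) ?nnegrE ?mulr_ge0 ?sqrtr_ge0 ?exprn_ge0 //.
  rewrite !exprMn sqr_sqrtr // -exprM -!natrX -!natrM ler_nat.
  case: h h0 {kh kle hR} => // h _; have := bin_center h.
  have -> : (16 ^ h.+1 = 2 ^ (h.+1.*2 * 2))%N by rewrite -(expnM 2 4) -mul2n; congr expn; lia.
  by move/leq_trans; apply; rewrite leq_mul2r; apply/orP; right; lia.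
have near : 'C(h.*2, h)%:R <= 2 * 'C(h.*2, h - k)%:R :> R.
  have := bin_near_center kle.
  have : 2 * k%:R ^+ 2 <= h%:R :> R by rewrite -natrX -natrM ler_nat.
  move=> k2 H; rewrite -(ler_pM2l hR); move: H.
  have : 0 <= (h%:R - 2 * k%:R ^+ 2) * 'C(h.*2, h)%:R :> R by rewrite mulr_ge0 // subr_ge0.
  lra.
have s0 : 0 <= 2 * Num.sqrt h.*2%:R :> R by rewrite mulr_ge0 // sqrtr_ge0.
have P0 : 0 <= 2 ^+ h.*2 :> R by rewrite exprn_ge0.
have cardR : 2 ^+ h.*2 * 'C(h.*2, h - k)%:R <= #|U_supp h.*2 k.*2|%:R :> R.
  by rewrite -natrX -natrM ler_nat card_U_supp_ge.
rewrite expr2; apply: le_trans (ler_wpM2l P0 center) _.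
have := ler_wpM2l P0 (ler_wpM2l s0 near); have := ler_wpM2l s0 cardR; lra.
Qed.

End Binomials.

Lemma double_sqr_lt k h : (k.*2 ^ 2 < h.*2)%N -> (2 * k ^ 2 <= h)%N.
Proof. by rewrite -!mul2n expnMn; lia. Qed.

Lemma sqr_double_ge k : (k <= 2 * k ^ 2)%N.
Proof. by rewrite expnS expn1; nia. Qed.

(** * Success probability of a short protocol *)

Section Advantage.
Variable R : realType.
Implicit Types beta : R.

Lemma supp_countT n k : supp_count R k [set: cube n] [set: cube n] = #|U_supp n k|%:R.
Proof.
rewrite /supp_count pair_big /= -sum1_card natr_sum [RHS]big_mkcond /=.
by apply: eq_big => [[x y]|[x y] _] /=; rewrite ?inE //; case: ifP.
Qed.

Lemma two_expR : 2 = expR (ln 2) :> R. Proof. by rewrite lnK ?posrE. Qed.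

Lemma ln2_ge_half : 2^-1 <= ln 2 :> R.
Proof. by have := @ln_ge1BV R 2 ltac:(by []); lra. Qed.

(** Since [ln 2 >= 1/2], saving [beta n] bits gains at least [exp (beta n / 2)], of which
    [exp (beta n / 4)] is spent; what remains is bounded by [exp (- y) <= 1 / y]. *)
Lemma transcript_term_small beta n c : 0 < beta -> (0 < n)%N ->
  c%:R <= (1 - beta) * n%:R ->
  2 ^+ c * (2 ^+ n * expR (2 * (beta / 8) * n%:R)) <=
    (2 ^+ n) ^+ 2 * (4 / (beta * n%:R)) :> R.
Proof.
move=> b0 n0 cn; have nR : 0 < n%:R :> R by rewrite ltr0n.
have pow2 m : 2 ^+ m = expR (m%:R * ln 2) :> R by rewrite expRM_natl -two_expR.
have y0 : 0 < beta * n%:R / 4 by rewrite divr_gt0 // mulr_gt0.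
have small : expR (- (beta * n%:R / 4)) <= 4 / (beta * n%:R).
  rewrite expRN -[4 / _]invf_div lef_pV2 ?posrE ?expR_gt0 //.
  by apply: le_trans (expR_ge1Dx _); lra.
have P0 : 0 <= (2 ^+ n) ^+ 2 :> R by rewrite exprn_ge0 // exprn_ge0.
apply: le_trans (ler_wpM2l P0 small).
rewrite -exprM !pow2 -!expRD ler_expR natrM.
have l2 := ln2_ge_half; have l0 : 0 <= ln 2 :> R by lra.
have h1 := ler_wpM2r l0 cn.
have : beta * n%:R * 2^-1 <= beta * n%:R * ln 2 by rewrite ler_pM2l // mulr_gt0.
lra.
Qed.

(** Each of the two error terms is at most a twelfth of the support, so twice the count is at most
    7/6 of it. This fixes [768 = 12 * 64] and [192 = 12 * 16]; the minimum with 1 ensures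
    [U_supp_large] applies. *)
Lemma correct_count_small beta h k p : 0 < beta -> (0 < h)%N -> (0 < k)%N ->
  (192 / beta) ^+ 2 < h.*2%:R ->
  k.*2%:R < Num.min 1 (decay (beta / 8) / 768) * Num.sqrt h.*2%:R ->
  (forall x y : cube h.*2, (size (transcript p x y))%:R < (1 - beta) * h.*2%:R) ->
  correct_count R k.*2 p [set: _] [set: _] <= 7 / 12 * #|U_supp h.*2 k.*2|%:R.
Proof.
move=> b0 h0 k0 nbig kn size_p.
have e0 : 0 < beta / 8 by rewrite divr_gt0.
have c0 := decay_gt0 e0.
have n0 : (0 < h.*2)%N by rewrite double_gt0.
have nR : 0 < h.*2%:R :> R by rewrite ltr0n.
set s := Num.sqrt h.*2%:R in kn.
have s0 : 0 < s by rewrite sqrtr_gt0.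
have s2 : s ^+ 2 = h.*2%:R by rewrite sqr_sqrtr // ltW.
have min_lel (a b : R) : Num.min a b <= a by rewrite ge_min lexx.
have min_ler (a b : R) : Num.min a b <= b by rewrite ge_min lexx orbT.
have ks : k.*2%:R < s.
  by apply: lt_le_trans kn _; rewrite -[leRHS]mul1r (ler_wpM2r (ltW s0) (min_lel _ _)).
have kc : k.*2%:R < decay (beta / 8) / 768 * s.
  exact: lt_le_trans kn (ler_wpM2r (ltW s0) (min_ler _ _)).
have kh2 : (2 * k ^ 2 <= h)%N.
  have : k.*2%:R ^+ 2 < h.*2%:R :> R by rewrite -s2 ltrXn2r // ?nnegrE // ltW.
  by rewrite -natrX ltr_nat; exact: double_sqr_lt.
have kh : (k <= h)%N by exact: leq_trans (sqr_double_ge _) kh2.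
have Ularge := U_supp_large R h0 kh2; rewrite -/s in Ularge.
set N : R := #|_|%:R in Ularge *.
(* [beta] may exceed 1; the sign comes from a transcript length lying below this quantity. *)
have x0 : 0 <= (1 - beta) * h.*2%:R.
  by apply: le_trans (ltW (size_p [ffun=> false] [ffun=> false])).
set c := Num.truncn ((1 - beta) * h.*2%:R).
have /andP[cle clt] : c%:R <= (1 - beta) * h.*2%:R < c.+1%:R by rewrite truncn_itv.
have size_c x y : (size (transcript p x y) <= c)%N.
  by rewrite -ltnS -(ltr_nat R); apply: lt_trans clt.
have d0 : 0 <= 32 / decay (beta / 8) * (k%:R / h.*2%:R).
  by rewrite mulr_ge0 // divr_ge0 // ltW.
have t0 : 0 <= 2 ^+ h.*2 * expR (2 * (beta / 8) * h.*2%:R).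
  by rewrite mulr_ge0 ?exprn_ge0 ?expR_ge0.
have k20 : (0 < k.*2)%N by rewrite double_gt0.
have := correct_count_le k20 d0 t0 (fun A B => discrepancy A B e0 kh h0)
  (c := c) (p := p) (A := [set: _]) (B := [set: _]) (fun x y _ _ => size_c x y).
rewrite supp_countT -/N cardsT card_ffun card_bool card_ord natrX.
set S := correct_count _ _ _ _ _ => H.
have P0 : 0 <= (2 ^+ h.*2) ^+ 2 :> R by rewrite exprn_ge0 // exprn_ge0.
have term1 : 32 / decay (beta / 8) * (k%:R / h.*2%:R) * (2 ^+ h.*2 * 2 ^+ h.*2) <= N / 12.
  rewrite -expr2; apply: le_trans (ler_wpM2l d0 Ularge) _.
  have -> : 32 / decay (beta / 8) * (k%:R / h.*2%:R) * (4 * s * N) =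
      (k.*2%:R / (decay (beta / 8) / 64 * s)) * N.
    rewrite -s2 -mul2n natrM; move: (decay _) c0 => cc cc0.
    by field; rewrite !gt_eqF.
  have ds0 : 0 < decay (beta / 8) / 64 * s by exact: mulr_gt0 (divr_gt0 c0 _) s0.
  rewrite mulrC ler_wpM2l // ler_pdivrMr //.
  apply: le_trans (ltW kc) _.
  by rewrite le_eqVlt; apply/orP; left; apply/eqP; field.
have term2 : 2 ^+ c * (2 ^+ h.*2 * expR (2 * (beta / 8) * h.*2%:R)) <= N / 12.
  apply: le_trans (transcript_term_small b0 n0 cle) _.
  have q0 : 0 <= 4 / (beta * h.*2%:R) by rewrite divr_ge0 // mulr_ge0 // ltW.
  apply: le_trans (ler_wpM2r q0 Ularge) _.
  have -> : 4 * s * N * (4 / (beta * h.*2%:R)) = (16 / (beta * s)) * N.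
    by rewrite -s2; field; rewrite !gt_eqF.
  rewrite mulrC ler_wpM2l // ler_pdivrMr ?mulr_gt0 //.
  have : 192 / beta < s by rewrite -(@ltr_pXn2r _ 2) ?nnegrE ?divr_ge0 ?(ltW s0) ?(ltW b0) // s2.
  rewrite ltr_pdivrMr // => bs.
  have final1 (z : R) : 192 < z -> 16 <= 12^-1 * z by lra.
  by apply: final1; rewrite mulrC.
have final2 (S' N' u v : R) : 2 * S' <= N' + u + v -> u <= N' / 12 -> v <= N' / 12 ->
  S' <= 7 / 12 * N' by lra.
exact: final2 H term1 term2.
Qed.

(** Averaging over the coins: after exchanging the sum over inputs with the integral, each outcome
    contributes the success rate of a deterministic protocol. *)
Lemma EGH_success_le n k (p : rprotocol R (cube n) (cube n) (option bool)) (r : R) :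
  (forall w : coin p, correct_count R k (run w) [set: _] [set: _] <= r * #|U_supp n k|%:R) ->
  0 <= r -> (EGH_success k p <= r%:E)%E.
Proof.
move=> hr r0; rewrite /EGH_success.
pose E (xy : cube n * cube n) : set (coin p) :=
  [set w | output (run w) xy.1 xy.2 = EGH k xy.1 xy.2]%classic.
have mE xy : measurable (E xy) by exact: measurable_output.
have U0 (xy : cube n * cube n) : 0 <= U R k xy by rewrite /U; case: ifP => // _; rewrite invr_ge0.
have mI xy : measurable_fun setT ((fun w => (\1_(E xy) w)%:E) : coin p -> \bar R).
  exact/measurable_EFinP/measurable_indic.
have I0 xy w : (0 <= (U R k xy)%:E * (\1_(E xy) w : R)%:E)%E.
  by rewrite mule_ge0 // lee_fin.
have mUI xy : 
    measurable_fun setT ((fun w => (U R k xy)%:E * (\1_(E xy) w)%:E)%E : coin p -> \bar R).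
  exact: emeasurable_funM.
have pt xy : ((U R k xy)%:E * coin_law p (E xy) =
    \int[coin_law p]_w ((U R k xy)%:E * (\1_(E xy) w)%:E))%E.
  rewrite (ge0_integralZl _ measurableT (mI xy)) ?lee_fin //.
  by rewrite integral_indic // setIT.
rewrite (eq_bigr _ (fun xy _ => pt xy)) -ge0_integral_sum //.
have -> : r%:E = (\int[coin_law p]_w (cst r%:E w))%E.
  rewrite integral_cst //; have := probability_setT (coin_law p) => /= total.
  by rewrite total mule1.
apply: ge0_le_integral => //.
- by move=> w _; apply: sume_ge0 => xy _.
- exact: emeasurable_sum.
move=> w _ /=.
under eq_bigr do rewrite -EFinM.
rewrite sumEFin lee_fin.
have -> : \sum_xy U R k xy * \1_(E xy) w =
    correct_count R k (run w) [set: _] [set: _] / #|U_supp n k|%:R.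
  rewrite /correct_count pair_big /= mulr_suml; apply: eq_big => [[x y]|[x y] _].
    by rewrite !inE.
  have -> : (\1_(E (x, y)) w : R) = (output (run w) x y == EGH k x y)%:R.
    by rewrite indicE; congr _%:R; congr nat_of_bool; apply/idP/eqP; rewrite inE.
  by rewrite /U; case: ifP => _ /=; rewrite ?mul0r // mulrC.
have [->|N0] := posnP #|U_supp n k|; first by rewrite invr0 mulr0.
by rewrite ler_pdivrMr ?ltr0n.
Qed.

End Advantage.

Theorem theorem6 (R : realType) (beta : R) (hbeta : 0 < beta) :
  exists (n0 : nat) (alpha : R),
    [/\ (0 < n0)%N, 0 < alpha &
      forall n k : nat,
        (0 < n)%N -> ~~ odd n -> (0 < k)%N -> ~~ odd k ->
        (n0 < n)%N -> k%:R < alpha * Num.sqrt (n%:R : R) ->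
        forall p : rprotocol R (cube n) (cube n) (option bool),
          ((2 / 3 : R)%:E <= EGH_success k p)%E ->
          (((1 - beta) * n%:R)%:E <= communication_complexity p)%E].
Proof.
set alpha := Num.min 1 (decay (beta / 8) / 768).
(* Any larger [n] satisfies [sqrt n > 192 / beta], as needed for the term counting transcripts. *)
exists (Num.truncn ((192 / beta) ^+ 2)).+1, alpha; split => //.
  have decay0 : 0 < decay (beta / 8) by apply: decay_gt0; exact: divr_gt0.
  have inv0 : 0 < 768^-1 :> R by rewrite invr_gt0 ltr0n.
  by rewrite /alpha lt_min (mulr_gt0 decay0 inv0) andbT.
(* Contrapositive: a cost below [(1 - beta) n] forces success at most [7/12 < 2/3]. *)
move=> n k n_gt0 n_even k_gt0 k_even n_big k_small p; apply: contraTT; rewrite -!ltNge => cc.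
rewrite -(even_halfK n_even) -(even_halfK k_even) in p n_gt0 k_gt0 n_big k_small cc *.
set h := n./2 in p n_gt0 k_gt0 n_big k_small cc *; set j := k./2 in k_gt0 k_small *.
rewrite !double_gt0 in n_gt0 k_gt0.
apply: (@le_lt_trans _ _ (7 / 12)%:E); last by rewrite lte_fin; lra.
apply: EGH_success_le => [w|]; last by rewrite divr_ge0.
apply: (@correct_count_small R beta) => //.
  by apply: lt_trans (truncnS_gt _) _; rewrite ltr_nat.
move=> x y; rewrite -lte_fin; apply: le_lt_trans cc.
by apply: ereal_sup_ubound; exists w, x, y.
Qed.
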